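(* Let $\nu>0$, $\alpha\in[1,5/4)$, $T>0$, and let $U$ be the divergence-free field on $\mathbb{T}^3$ constructed in the context (with this $\alpha$). Let $u\in C_w([0,T);L^2(\mathbb{T}^3))\cap L^2([0,T);H^{1}(\mathbb{T}^3))$ be a weak solution of $$u_t+(u\cdot\nabla)u=-\nu(-\Delta)^{\alpha}u-\nabla p,\qquad \nabla\cdot u=0,$$ on $\mathbb{T}^3$ with initial condition $u(0)=U$. Then there is $\delta=\delta(u)>0$ such that $$\limsup_{t\to0+}\|u(t)-U\|_{B^{1-2\alpha}_{\infty,\infty}}\ge\delta .$$ If, in addition, $u$ is a Leray-Hopf solution satisfying the energy inequality $$|u(t)|_2^2+2\nu\int_0^t\big||\nabla|^{\alpha}u(s)\big|_2^2\,ds\le|U|_2^2\qquad\text{for all } t\in(0,T),$$ then $\delta$ can be chosen independent of $u$.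
   Context: Conventions. $\mathbb{T}^3=(\mathbb{R}/2\pi\mathbb{Z})^3$ is the 3D torus (periodic boundary conditions); $|\cdot|_p$ is the $L^p(\mathbb{T}^3)$-norm; $\hat f(\xi)$, $\xi\in\mathbb{Z}^3$, denotes the Fourier coefficients of $f$, so $f(x)=\sum_{\xi}\hat f(\xi)e^{i\xi\cdot x}$. $|\nabla|^{\alpha}$ is the Fourier multiplier with symbol $|\xi|^{\alpha}$, and $(-\Delta)^{\alpha}$ has symbol $|\xi|^{2\alpha}$. $H^1$ is the usual $L^2$-based Sobolev space of order 1. $C_w([0,T);L^2)$ is the space of weakly continuous $L^2$-valued functions; weak solutions are understood in the usual distributional sense, $u(x,t)\in\mathbb{R}^3$ being the velocity and $p(x,t)$ the pressure. Besov spaces. Put $\lambda_q=2^q$. Use the classical dyadic (Littlewood-Paley) decomposition $u=\sum_{q\ge0}u_q$, where for $q\geq 1$ $u_q$ is the Littlewood-Paley projection of $u$ with Fourier support in $\{\lambda_{q-1}<|\xi|<\lambda_{q+1}\}$ (and $u_0$ is the low-frequency part). For $s\in\mathbb{R}$, $r\ge1$, $B^s_{r,\infty}$ is defined by $$\|u\|_{B^s_{r,\infty}}=\sup_{q\ge0}\lambda_q^s|u_q|_r<\infty .$$ Construction of $U$. Let $p(\xi)=\mathrm{id}-|\xi|^{-2}\xi\otimes\xi$ for $\xi\ne0$, $p(0)=\mathrm{id}$, be the symbol of the Leray-Hopf projection on divergence-free fields. Let $\vec e_1,\vec e_2$ be the first two standard unit basis vectors of $\mathbb{R}^3$ and put $\vec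 e_1(\xi)=p(\xi)\vec e_1$, $\vec e_2(\xi)=p(\xi)\vec e_2$. Choose a strictly increasing sequence $(q_i)_{i\ge1}\subset\mathbb{N}$ with elements sufficiently far apart so that at least $\lambda_{q_i}^{2\alpha}\lambda_{q_{i+1}}^{4\alpha-5}<1$ for all $i$. Define the lattice blocks $$A_j=\Big(\big[\tfrac{9}{10}\lambda_{q_j},\tfrac{11}{10}\lambda_{q_j}\big]\times\big[-\tfrac1{10}\lambda_{q_j},\tfrac1{10}\lambda_{q_j}\big]^2\Big)\cap\mathbb{Z}^3,$$ $$B_j=\Big(\big[-\tfrac1{10}\lambda_{q_j-1},\tfrac1{10}\lambda_{q_j-1}\big]^2\times\big[\tfrac9{10}\lambda_{q_j-1},\tfrac{11}{10}\lambda_{q_j-1}\big]\Big)\cap\mathbb{Z}^3,$$ $$C_j=A_j+B_j,\quad A_j^*=-A_j,\quad B_j^*=-B_j,\quad C_j^*=-C_j,$$ where $A_j+B_j$ is the sumset. With $\chi_S$ the characteristic function of $S$, set $$U=\sum_{j\ge1}(U_{q_j}+U_{q_j-1}),$$ where $$\widehat{U_{q_j}}(\xi)=\lambda_{q_j}^{2\alpha-4}\Big(\vec e_2(\xi)\chi_{A_j\cup A_j^*}(\xi)+i(\vec e_2(\xi)-\vec e_1(\xi))\chi_{C_j}(\xi)-i(\vec e_2(\xi)-\vec e_1(\xi))\chi_{C_j^*}(\xi)\Big),$$ $$\widehat{U_{q_j-1}}(\xi)=\lambda_{q_j}^{2\alpha-4}\,\vec e_1(\xi)\chi_{B_j\cup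 B_j^*}(\xi).$$ The field $U$ is real-valued and belongs to $L^2(\mathbb{T}^3)$. *)

(* Defs.v *)
From HB Require Import structures.
From mathcomp Require Import all_boot all_order all_algebra.
From mathcomp Require Import all_classical all_reals all_analysis.
From mathcomp Require Import complex.

Set Implicit Arguments.
Unset Strict Implicit.
Unset Printing Implicit Defensive.
Import Order.TTheory GRing.Theory Num.Theory.
Import numFieldNormedType.Exports.
Local Open Scope classical_set_scope.
Local Open Scope ring_scope.
Local Open Scope complex_scope.

(* Functions on the torus T^3 = (R / 2 pi Z)^3 are represented by functions on
   R^3 of which only the values on the fundamental cell [0, 2 pi[^3 matter
   (this is the support of torus_measure).  Only the test functions below are
   differentiated pointwise; they are required to be genuinely periodic. *)
Notation pt3 R := ((R * R) * R)%type.
(* the dual lattice Z^3 *)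
Notation freq := 'rV[int]_3.

Section Torus.
Context {R : realType}.

Lemma circle_measurable :
  measurable (`[0, 2 * pi[%classic : set (measurableTypeR R)).
Proof. exact: measurable_itv. Qed.

Lemma circle_finite :
  (@lebesgue_measure R `[0%R, (2 * pi)%R[%classic < +oo)%E.
Proof.
by rewrite lebesgue_measure_itv /=; case: ifP => _ //; rewrite -EFinD ltry.
Qed.

Definition circle_measure := mfrestr circle_measurable circle_finite.
HB.instance Definition _ := FiniteMeasure.on circle_measure.

Definition torus_measure :=
  ((circle_measure \x circle_measure) \x circle_measure)%E.
HB.instance Definition _ := Measure.on torus_measure.

Definition coord (x : pt3 R) (k : 'I_3) : R :=
  tnth [tuple x.1.1; x.1.2; x.2] k.

Definition basis (k : 'I_3) : pt3 R :=
  (((k == 0)%:R, (k == 1)%:R), (k == 2%:R)%:R).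

(* Euclidean norm; the norm that the library puts on matrices is the max norm *)
Definition enorm (v : 'rV[R]_3) : R := Num.sqrt (\sum_k v 0 k ^+ 2).

Definition Lp_norm (p : \bar R) (f : pt3 R -> 'rV[R]_3) : \bar R :=
  Lnorm torus_measure p (fun x => (enorm (f x))%:E).

Definition L2 (f : pt3 R -> 'rV[R]_3) : Prop :=
  forall k, (fun x => f x 0 k) \in Lfun torus_measure 2%:E.

Definition inner (f g : pt3 R -> 'rV[R]_3) : R :=
  \int[torus_measure]_x (\sum_k f x 0 k * g x 0 k).

(* Fourier series, normalized so that f = \sum_xi (fourier f xi) e^{i xi.x} *)

Definition freqR (xi : freq) : 'rV[R]_3 := map_mx intr xi.

Definition phase (xi : freq) (x : pt3 R) : R :=
  \sum_k freqR xi 0 k * coord x k.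

Definition fourier (f : pt3 R -> R) (xi : freq) : R[i] :=
  ((2 * pi) ^- 3 * \int[torus_measure]_x (f x * cos (phase xi x)))
  -i* ((2 * pi) ^- 3 * \int[torus_measure]_x (f x * sin (phase xi x))).

Definition fourierv (f : pt3 R -> 'rV[R]_3) (xi : freq) : 'rV[R[i]]_3 :=
  \row_k fourier (fun x => f x 0 k) xi.

(* The field with Fourier coefficients c, for c of finite support.  It is only
   used when c (- xi) is conjugate to c xi: the sum is then already real. *)
Definition synthesis (c : freq -> 'rV[R[i]]_3) (x : pt3 R) : 'rV[R]_3 :=
  map_mx (@complex.Re R)
    (\sum_(xi \in [set: freq])
        (cos (phase xi x) +i* sin (phase xi x)) *: c xi).

(* symbol of |nabla|^s *)
Definition abs_pow (s : R) (xi : freq) : R := enorm (freqR xi) `^ s.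

(* g = m(D) f *)
Definition is_multiplier (m : freq -> R) (f g : pt3 R -> 'rV[R]_3) : Prop :=
  forall xi, fourierv g xi = (m xi)%:C *: fourierv f xi.

(* |m(D) f|_2, with value +oo when m(D) f is not an L^2 field
   (m(D) f is unique up to a null set, so that the set below is empty or a
   singleton) *)
Definition multiplier_norm (m : freq -> R) (f : pt3 R -> 'rV[R]_3) : \bar R :=
  ereal_inf [set Lp_norm 2%:E g | g in [set g | L2 g /\ is_multiplier m f g]].

Definition H1_norm : (pt3 R -> 'rV[R]_3) -> \bar R :=
  multiplier_norm (fun xi => Num.sqrt (1 + enorm (freqR xi) ^+ 2)%R).

(* Besov spaces *)

Fixpoint Ck (V : normedModType R) (n : nat) (f : V -> R) : Prop :=
  continuous f /\
  if n is n'.+1 then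
    forall v, (forall x, derivable f x v) /\ Ck n' (fun x => 'D_v f x)
  else True.

Definition smooth (V : normedModType R) (f : V -> R) : Prop :=
  forall n, Ck n f.

(* radial profile of the Littlewood-Paley low-frequency cut-off *)
Definition LP_cutoff (chi : R -> R) : Prop :=
  [/\ smooth (chi : R^o -> R),
      forall r, 0 <= chi r <= 1,
      forall r, r <= 2^-1 -> chi r = 1
    & forall r, 1 <= r -> chi r = 0].

Definition lambda (q : int) : R := 2 ^ q.

(* For q >= 1 the symbol is supported in lambda (q - 1) < |xi| < lambda (q + 1);
   the symbols add up to 1. *)
Definition LP_symbol (chi : R -> R) (q : nat) (xi : freq) : R :=
  let r := enorm (freqR xi) in
  if q is 0%N then chi (r / 2)
  else chi (r / lambda (q%:Z + 1)) - chi (r / lambda q%:Z).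

Definition LP_block (chi : R -> R) (q : nat) (f : pt3 R -> 'rV[R]_3) :
    pt3 R -> 'rV[R]_3 :=
  synthesis (fun xi => (LP_symbol chi q xi)%:C *: fourierv f xi).

(* the norm of B^s_{r, oo} *)
Definition besov_norm (chi : R -> R) (s : R) (r : \bar R)
    (f : pt3 R -> 'rV[R]_3) : \bar R :=
  ereal_sup [set (lambda q%:Z `^ s)%:E * Lp_norm r (LP_block chi q f)
            | q in [set: nat]]%E.

(* The initial datum *)

Definition leray (xi : freq) : 'M[R]_3 :=
  if xi == 0 then 1%:M
  else 1%:M - enorm (freqR xi) ^- 2 *: ((freqR xi)^T *m freqR xi).

(* p(xi) is symmetric: it may act on row vectors *)
Definition evec (k : 'I_3) (xi : freq) : 'rV[R[i]]_3 :=
  map_mx (real_complex R) (delta_mx 0 k *m leray xi).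

(* In the next definitions q stands for q_j. *)
Definition blockA (q : nat) : set freq :=
  [set xi | [/\ 9 / 10 * lambda q%:Z <= freqR xi 0 0 <= 11 / 10 * lambda q%:Z,
                `|freqR xi 0 1| <= lambda q%:Z / 10
              & `|freqR xi 0 2%:R| <= lambda q%:Z / 10]].

Definition blockB (q : nat) : set freq :=
  [set xi | [/\ `|freqR xi 0 0| <= lambda (q%:Z - 1) / 10,
                `|freqR xi 0 1| <= lambda (q%:Z - 1) / 10
              & 9 / 10 * lambda (q%:Z - 1) <= freqR xi 0 2%:R
                  <= 11 / 10 * lambda (q%:Z - 1)]].

Definition blockC (q : nat) : set freq :=
  [set a + b | a in blockA q & b in blockB q].

Definition reflected (S : set freq) : set freq := [set - xi | xi in S].

Definition char_fun (S : set freq) (xi : freq) : R[i] := (\1_S xi : R)%:C.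

Definition hatU_top (alpha : R) (q : nat) (xi : freq) : 'rV[R[i]]_3 :=
  (lambda q%:Z `^ (2 * alpha - 4))%:C *:
    (char_fun (blockA q `|` reflected (blockA q)) xi *: evec 1 xi
     + ('i%C * char_fun (blockC q) xi) *: (evec 1 xi - evec 0 xi)
     - ('i%C * char_fun (reflected (blockC q)) xi) *: (evec 1 xi - evec 0 xi)).

Definition hatU_sub (alpha : R) (q : nat) (xi : freq) : 'rV[R[i]]_3 :=
  (lambda q%:Z `^ (2 * alpha - 4))%:C *:
    (char_fun (blockB q `|` reflected (blockB q)) xi *: evec 0 xi).

Definition partialU (alpha : R) (q : nat -> nat) (n : nat) (x : pt3 R) :
    'rV[R]_3 :=
  \sum_(j < n) (synthesis (hatU_top alpha (q j)) x
                + synthesis (hatU_sub alpha (q j)) x).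

(* U = \sum_j (U_{q_j} + U_{q_j - 1}), the series being summed in L^2 *)
Definition is_initial_field (alpha : R) (q : nat -> nat)
    (U : pt3 R -> 'rV[R]_3) : Prop :=
  L2 U /\
  (fun n => Lp_norm 2%:E (fun x => U x - partialU alpha q n x)) @ \oo --> 0%E.

Definition admissible_scales (alpha : R) (q : nat -> nat) : Prop :=
  {homo q : i j / (i < j)%N} /\
  forall i, lambda (q i)%:Z `^ (2 * alpha)
              * lambda (q i.+1)%:Z `^ (4 * alpha - 5) < 1.

(* Weak solutions *)

(* C^oo_c (]0, T[ x T^3), extended by 0 to all times *)
Definition test_function (T : R) (phi : R * pt3 R -> R) : Prop :=
  [/\ smooth phi,
      forall t x k, phi (t, x + (2 * pi) *: basis k) = phi (t, x)
    & exists a b, [/\ 0 < a, b < T &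
        forall t x, ~ (a <= t <= b) -> phi (t, x) = 0]].

Definition dt (phi : R * pt3 R -> R) (t : R) (x : pt3 R) : R :=
  'D_((1, 0) : R * pt3 R) phi (t, x).

Definition dx (k : 'I_3) (phi : R * pt3 R -> R) (t : R) (x : pt3 R) : R :=
  'D_((0, basis k) : R * pt3 R) phi (t, x).

Definition velocity := R -> pt3 R -> 'rV[R]_3.

Definition weakly_continuous (T : R) (u : velocity) : Prop :=
  (forall t, 0 <= t < T -> L2 (u t)) /\
  (forall g, L2 g -> {within `[0, T[, continuous (fun t => inner (u t) g)}).

Definition in_L2H1 (T : R) (u : velocity) : Prop :=
  (\int[lebesgue_measure]_(t in `[0%R, T[) (H1_norm (u t) ^+ 2) < +oo)%E.

Definition divergence_free (T : R) (u : velocity) : Prop :=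
  forall theta, test_function T theta ->
    \int[lebesgue_measure]_(t in `]0, T[)
      \int[torus_measure]_x (\sum_k u t x 0 k * dx k theta t x) = 0.

(* u_t + div (u (x) u) + nu (-Delta)^alpha u = - grad p in distributions for
   some p: both sides are paired with the divergence-free test fields phi,
   which eliminates p.  Lphi is (-Delta)^alpha phi. *)
Definition momentum (nu alpha T : R) (u : velocity) : Prop :=
  forall (phi : R * pt3 R -> 'rV[R]_3) (Lphi : velocity),
    (forall k, test_function T (fun z => phi z 0 k)) ->
    (forall t x, \sum_k dx k (fun z => phi z 0 k) t x = 0) ->
    (forall t, L2 (Lphi t) /\
       is_multiplier (abs_pow (2 * alpha)) (fun x => phi (t, x)) (Lphi t)) ->
    \int[lebesgue_measure]_(t in `]0, T[)
      \int[torus_measure]_x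
        (\sum_k u t x 0 k * dt (fun z => phi z 0 k) t x
         + \sum_k \sum_l u t x 0 k * u t x 0 l * dx k (fun z => phi z 0 l) t x
         - nu * \sum_k u t x 0 k * Lphi t x 0 k) = 0.

(* u (0) = U in L^2 *)
Definition weak_solution (nu alpha T : R) (U : pt3 R -> 'rV[R]_3)
    (u : velocity) : Prop :=
  [/\ weakly_continuous T u,
      in_L2H1 T u,
      divergence_free T u,
      momentum nu alpha T u
    & {ae torus_measure, forall x, u 0 x = U x}].

Definition energy_inequality (nu alpha T : R) (U : pt3 R -> 'rV[R]_3)
    (u : velocity) : Prop :=
  forall t, 0 < t < T ->
    (Lp_norm 2%:E (u t) ^+ 2
     + (2 * nu)%:E * \int[lebesgue_measure]_(s in `[0%R, t])
         (multiplier_norm (abs_pow alpha) (u s) ^+ 2)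
     <= Lp_norm 2%:E U ^+ 2)%E.

Definition besov_limsup (chi : R -> R) (alpha : R) (U : pt3 R -> 'rV[R]_3)
    (u : velocity) : \bar R :=
  limf_esup
    (fun t => besov_norm chi (1 - 2 * alpha) +oo%E (fun x => u t x - U x))
    (0^'+).

End Torus.

(* Main.v *)
From HB Require Import structures.
Require Import Defs.
From mathcomp Require Import all_boot all_order all_algebra.
From mathcomp Require Import all_classical all_reals all_analysis.
From mathcomp Require Import measurable_realfun ess_sup_inf.
From mathcomp Require Import complex ring lra zify.
Set Implicit Arguments.
Unset Strict Implicit.
Unset Printing Implicit Defensive.
Import Order.TTheory GRing.Theory Num.Theory.
Import numFieldNormedType.Exports.
Local Open Scope classical_set_scope.
Local Open Scope ring_scope.
Local Open Scope complex_scope.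

(** A field v in H^1 lies in the closure of the smooth fields in the Besov
    space B^s_{oo,oo}, s = 1 - 2 alpha: Cauchy-Schwarz over the roughly lambda^3
    frequencies of size lambda gives
      |v_q|_oo <~ lambda^(3/2) |v_q|_2 <~ lambda^(1/2) |v|_{H^1},
    which is o(lambda^(2 alpha - 1)) since alpha >= 1.  The datum U stays away
    from that closure: the modes of the block A_j, roughly lambda^3 of them with
    amplitude lambda^(2 alpha - 4), all add up with the same sign at the origin,
    so that |U_q|_oo >~ lambda^(2 alpha - 1) at the scales lambda = 2^(q_j).
    Hence |v - U|_{B^s_{oo,oo}} >= gap for every v in H^1, with a numerical
    constant gap (lemma besov_gap).  As u is in L^2 H^1, the field u(t) is in H^1
    for times t arbitrarily close to 0 (lemma in_L2H1_frequently), and the upper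
    limit is at least gap for every solution u.

    Both estimates concern the second component of Littlewood-Paley blocks at
    the point 0, which bounds the L^oo norm of a trigonometric polynomial from
    below (synthesis_at0_le).  For a real even symbol m of finite support, the
    value of m(D) f at 0 is (2 pi)^-3 \int f K with the cosine kernel
    K = \sum_xi m(xi) cos(xi.x); everything reduces to integrals of products of
    trigonometric functions.

    - For v in H^1 (H1_pairing), moving the factor (1 + |xi|^2)^(1/2) from v to
      the kernel leaves a kernel whose squared L^2 norm is at most C lambda.
    - For U (initial_field_pairing), the partial sums are paired mode by mode.
      The modes of the C_j are purely imaginary and contribute nothing to a
      value at 0; those of the B_j cancel under the reflection xi_2 -> - xi_2
      (sum_hatU_sub); all those of the A_j contribute nonnegatively, and a cube
      of (lambda/32)^3 of them contributes at least half the amplitude each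
      (sum_hatU_top_ge).

    The radial profile chi may take any value in [0, 1] on ]1/2, 1[, so that a
    single Littlewood-Paley symbol may be small on A_j; two consecutive symbols
    telescope and add up to 1 on lambda/2 <= |xi| <= lambda (LP_pair_eq1). *)

(** * Integrals over the circle *)

Section Circle.
Context {R : realType}.
Implicit Types (k : int) (th : R).

Lemma continuous_cos_affine (a th : R) :
  continuous (fun x : R => cos (a * x + th)).
Proof.
move=> x; apply: continuous_comp; last exact: continuous_cos.
by apply: cvgD; [apply: cvgM; [exact: cvg_cst|exact: cvg_id]|exact: cvg_cst].
Qed.

Lemma circle_measureE (A : set (measurableTypeR R)) :
  circle_measure A = lebesgue_measure (A `&` `[0, 2 * pi[).
Proof. by []. Qed.

Lemma circle_measure_setT : circle_measure setT = (2 * pi)%:E :> \bar R.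
Proof.
rewrite /circle_measure /mfrestr /mrestr /= setTI lebesgue_measure_itv /=.
by rewrite lte_fin mulr_gt0 ?pi_gt0// -EFinB subr0.
Qed.

Lemma circle_measure_lty : (circle_measure setT < +oo :> \bar R)%E.
Proof. by rewrite circle_measure_setT ltry. Qed.

Lemma circle_integralE (f : R -> R) :
  circle_measure.-integrable setT (EFin \o f) ->
  (\int[circle_measure]_x (f x)%:E
   = \int[lebesgue_measure]_(x in `[0%R, (2 * pi)%R[) (f x)%:E)%E.
Proof.
move=> fi; have mN : measurable (~` `[0%R, (2 * pi)%R[ : set (measurableTypeR R)).
  by apply: measurableC; exact: measurable_itv.
rewrite (@negligible_integral _ _ _ circle_measure setT
  (~` `[0%R, (2 * pi)%R[)) //=; last first.
  by rewrite /circle_measure/mfrestr /mrestr setICl measure0.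
rewrite setTD setCK; apply: eq_measure_integral => A mA AD.
by rewrite -[LHS]/(circle_measure A) circle_measureE setIidl.
Qed.

Lemma sin_add_period k th : sin (k%:~R * (2 * pi) + th) = sin th.
Proof.
have per (n : nat) (t : R) : sin (n%:R * (2 * pi) + t) = sin t.
  rewrite -[RHS](periodicn (@sinD2pi R) n t) addrC; congr (sin (_ + _)).
  by rewrite -mulrnA mulrA -natrM mulr_natl mulnC.
case: k => n; first exact: per.
by rewrite -[LHS](per n.+1) NegzE mulrNz mulNr addrA subrr add0r.
Qed.

Lemma circle_integral_cos k th :
  (\int[circle_measure]_x (cos (k%:~R * x + th))%:E
   = (if k == 0 then 2 * pi * cos th else 0)%:E)%E.
Proof.
have mc : measurable_fun setT (fun x : R => cos (k%:~R * x + th)).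
  by apply: continuous_measurable_fun; exact: continuous_cos_affine.
rewrite circle_integralE; last first.
  apply: measurable_bounded_integrable => //.
    exact: circle_measure_lty.
  exists 1; split=> // M M1 x _ /=; rewrite (le_trans _ (ltW M1))//.
  by rewrite ler_norml cos_geN1 cos_le1.
rewrite integral_itv_bndo_bndc; last first.
  by apply/measurable_EFinP; apply: measurable_funTS.
have pi0 : 0 < 2 * pi :> R by rewrite mulr_gt0 ?pi_gt0.
case: eqP => [->|/eqP k0].
  under eq_integral do rewrite mul0r add0r.
  rewrite integral_cst//= lebesgue_measure_itv/= lte_fin pi0 -EFinB subr0 -EFinM.
  by rewrite mulrC.
have kR0 : (k%:~R : R) != 0 by rewrite intr_eq0.
pose F (x : R) := (k%:~R)^-1 * sin (k%:~R * x + th).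
have dF (x : R) : is_derive x 1 F (cos (k%:~R * x + th)).
  have dg : is_derive x 1 (fun x : R => k%:~R * x + th) (k%:~R).
    have : is_derive x 1 (k%:~R \*: id + cst th : R -> R) (k%:~R *: 1 + 0).
      by apply: is_deriveD.
    by rewrite addr0 /GRing.scale/= mulr1.
  have := is_deriveZ (k%:~R^-1 : R) (is_derive1_comp (is_derive_sin _) dg).
  by rewrite /GRing.scale /= mulrC mulfK.
have cF : continuous F.
  by move=> x; apply/differentiable_continuous/derivable1_diffP; apply: ex_derive.
rewrite (@continuous_FTC2 _ _ F)//.
- rewrite -EFinB /F; congr EFin.
  by rewrite sin_add_period mulr0 add0r subrr.
- exact/continuous_subspaceT/continuous_cos_affine.
- split; first by move=> x _; apply: ex_derive.
  + apply: cvg_at_right_filter; exact: cF.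
  + apply: cvg_at_left_filter; exact: cF.
- by move=> x _; rewrite derive1E; exact: derive_val.
Qed.
End Circle.

(** * Integrals of characters over the torus *)

Section Torus.
Context {R : realType}.

(** The inner product measure inside torus_measure, named so that it can carry
    the finite-measure structure that Fubini's theorem asks for. *)
Definition torus2_measure := (@circle_measure R \x @circle_measure R)%E.
HB.instance Definition _ := Measure.on torus2_measure.

Lemma torus2_measure_fin : fin_num_fun torus2_measure.
Proof.
apply: lty_fin_num_fun => /=; rewrite -setXTT [ltLHS]product_measure1E//.
by rewrite lte_mul_pinfty ?circle_measure_lty// ge0_fin_numE ?circle_measure_lty.
Qed.
HB.instance Definition _ :=
  Measure_isFinite.Build _ _ R torus2_measure torus2_measure_fin.

Lemma torus_measure_fin : fin_num_fun (@torus_measure R).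
Proof.
apply: lty_fin_num_fun => /=.
rewrite -setXTT [ltLHS](product_measure1E torus2_measure)//.
rewrite lte_mul_pinfty ?circle_measure_lty//.
exact: fin_num_measure.
Qed.
HB.instance Definition _ :=
  Measure_isFinite.Build _ _ R (@torus_measure R) torus_measure_fin.

Lemma measurable_cos : measurable_fun setT (@cos R).
Proof. by apply: continuous_measurable_fun; exact: continuous_cos. Qed.

(** Integrating out one angle at a time: the inner integral of a shifted cosine
    of integer frequency k vanishes unless k = 0.  Used once per coordinate. *)
Lemma integral_prod_circle d (X : measurableType d)
    (m : {finite_measure set X -> \bar R}) (k : int) (p : X -> R) :
  measurable_fun setT p ->
  (\int[m \x circle_measure]_z (cos (k%:~R * z.2 + p z.1))%:E
   = (if k == 0 then 2 * pi else 0)%:E * \int[m]_x (cos (p x))%:E)%E.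
Proof.
move=> mp.
have mf : measurable_fun setT
    (fun z : X * measurableTypeR R => cos (k%:~R * z.2 + p z.1)).
  apply: measurableT_comp; first exact: measurable_cos.
  apply: measurable_funD; first by apply: measurable_funM => //; exact: measurable_snd.
  by apply: measurableT_comp => //; exact: measurable_fst.
rewrite -(@integral12_prod_meas1 _ _ _ _ R m circle_measure)/fubini_F/=; last first.
  apply: measurable_bounded_integrable => //.
    rewrite -setXTT [ltLHS]product_measure1E//.
    by rewrite lte_mul_pinfty ?circle_measure_lty// fin_num_measure.
  exists 1; split=> // M M1 x _ /=; rewrite (le_trans _ (ltW M1))//.
  by rewrite ler_norml cos_geN1 cos_le1.
under eq_integral => x _ do rewrite circle_integral_cos.
case: eqP => k0; last by rewrite integral0 mul0e.
under eq_integral => x _ do rewrite EFinM.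
rewrite integralZl//.
apply: measurable_bounded_integrable => //.
- by rewrite -ge0_fin_numE// fin_num_measure.
- by apply: measurableT_comp => //; exact: measurable_cos.
- exists 1; split=> // M M1 x _ /=; rewrite (le_trans _ (ltW M1))//.
  by rewrite ler_norml cos_geN1 cos_le1.
Qed.

Lemma phaseE (xi : freq) (x : pt3 R) :
  phase xi x
  = (xi 0 0)%:~R * x.1.1 + (xi 0 1)%:~R * x.1.2 + (xi 0 2%:R)%:~R * x.2.
Proof.
rewrite /phase !big_ord_recl big_ord0 addr0 addrA /freqR !mxE.
by congr (_ + _ + _); congr (_ * _); congr ((xi 0 _)%:~R); apply: val_inj.
Qed.

Lemma freq_eq0 (xi : freq) :
  (xi == 0) = [&& xi 0 0 == 0, xi 0 1 == 0 & xi 0 2%:R == 0].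
Proof.
apply/eqP/and3P => [->|[/eqP h0 /eqP h1 /eqP h2]]; first by rewrite !mxE.
apply/rowP => k; rewrite mxE.
by case: k => [[|[|[|//]]]] hk; [rewrite -[RHS]h0|rewrite -[RHS]h1|rewrite -[RHS]h2];
   congr (xi 0 _); apply: val_inj.
Qed.

Lemma torus_integral_cos (xi : freq) (th : R) :
  \int[torus_measure]_x cos (phase xi x + th)
   = if xi == 0 then (2 * pi) ^+ 3 * cos th else 0.
Proof.
rewrite /Rintegral.
have -> : (\int[torus_measure]_x (cos (phase xi x + th))%:E =
   \int[torus2_measure \x circle_measure]_z
     (cos ((xi 0 2%:R)%:~R * z.2 +
        ((xi 0 1)%:~R * z.1.2 + ((xi 0 0)%:~R * z.1.1 + th))))%:E)%E.
  apply: eq_integral => x _; congr (cos _)%:E; rewrite phaseE; ring.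
pose p (z : measurableTypeR R * measurableTypeR R) : R :=
  (xi 0 1)%:~R * z.2 + ((xi 0 0)%:~R * z.1 + th).
pose p1 (z : measurableTypeR R) : R := (xi 0 0)%:~R * z + th.
have mp1 : measurable_fun setT p1.
  by apply: measurable_funD => //; apply: measurable_funM.
have mp : measurable_fun setT p.
  apply: measurable_funD; first by apply: measurable_funM => //; exact: measurable_snd.
  by apply: (measurableT_comp mp1); exact: measurable_fst.
rewrite (integral_prod_circle torus2_measure _ mp).
rewrite [X in (_ * X)%E](integral_prod_circle circle_measure _ mp1) circle_integral_cos.
rewrite freq_eq0 -!EFinM /=.
by case: (xi 0 0 == 0); case: (xi 0 1 == 0); case: (xi 0 2%:R == 0) => /=;
  rewrite ?mul0r ?mulr0// !exprS expr0 mulr1 !mulrA.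
Qed.
End Torus.
Local Notation tint f := (torus_measure.-integrable setT (EFin \o f)).

(** * Finite cubes of frequencies *)

Section Box.
(** Cubes are kept as duplicate-free sequences: finitely supported sums over the
    lattice then become ordinary iterated sums, with a known number of terms. *)
Definition box (M : nat) : seq freq :=
  [seq \row_k ((f k : nat)%:Z - M%:Z) | f : {ffun 'I_3 -> 'I_(2 * M).+1}].

Lemma mem_box M (xi : freq) : (xi \in box M) = [forall k, `|xi 0 k| <= M%:Z].
Proof.
apply/mapP/forallP => [[f _ ->] k|h].
  rewrite mxE ler_norml; move: (f k) (ltn_ord (f k)) => [n /= hn] _; lia.
exists [ffun k : 'I_3 => inord (absz (xi 0 k + M%:Z))]; first by rewrite mem_enum.
apply/rowP => k; rewrite mxE ffunE.
move: (xi 0 k) (h k) => z; rewrite ler_norml => hz.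
have [n zM] : exists n : nat, z + M%:Z = n by exists (absz (z + M%:Z)); lia.
by rewrite zM absz_nat inordK; lia.
Qed.

Lemma uniq_box M : uniq (box M).
Proof.
rewrite map_inj_in_uniq ?enum_uniq// => f g _ _ /rowP fg.
apply/ffunP => k; apply: val_inj; have := fg k; rewrite !mxE /=; lia.
Qed.

Lemma size_box M : size (box M) = ((2 * M).+1 ^ 3)%N.
Proof. by rewrite size_map -cardE card_ffun !card_ord. Qed.

Lemma reindex_box (V : nmodType) M (h : freq -> freq) (F : freq -> V) :
  involutive h -> (forall xi, (h xi \in box M) = (xi \in box M)) ->
  \sum_(xi <- box M) F (h xi) = \sum_(xi <- box M) F xi.
Proof.
move=> hK hb; rewrite -(big_map h xpredT F); apply: perm_big.
apply: uniq_perm; rewrite ?uniq_box//.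
  by rewrite map_inj_uniq ?uniq_box//; exact: inv_inj.
by move=> xi; rewrite -hb -{1}[xi]hK (mem_map (inv_inj hK)).
Qed.

Lemma opp_box M (xi : freq) : (- xi \in box M) = (xi \in box M).
Proof. by rewrite !mem_box; apply: eq_forallb => k; rewrite mxE normrN. Qed.

Lemma fsum_box (V : nmodType) M (F : freq -> V) :
  (forall xi, xi \notin box M -> F xi = 0) ->
  \sum_(xi \in [set: freq]) F xi = \sum_(xi <- box M) F xi.
Proof.
move=> F0; rewrite (fsbigE (box M)) ?uniq_box//; last by move=> xi _; exact: F0.
by apply: eq_bigl => xi; rewrite in_setT.
Qed.
End Box.

(** * Cosine kernels *)

Section Kernel.
Context {R : realType}.
Implicit Types (f g : pt3 R -> R) (xi eta : freq) (m : freq -> R).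

Lemma tint_bounded f (B : R) :
  measurable_fun setT f -> (forall x, `|f x| <= B) -> tint f.
Proof.
move=> mf fB; apply: measurable_bounded_integrable => //.
  by rewrite -ge0_fin_numE// fin_num_measure.
exists B; split; first exact: num_real.
  by move=> M M1 x _ /=; rewrite (le_trans _ (ltW M1)).
Qed.

Lemma tintD f g : tint f -> tint g -> tint (fun x => f x + g x).
Proof.
by move=> hf hg; have := integrableD measurableT hf hg; apply: eq_integrable.
Qed.

Lemma tintB f g : tint f -> tint g -> tint (fun x => f x - g x).
Proof.
by move=> hf hg; have := integrableB measurableT hf hg; apply: eq_integrable.
Qed.

Lemma tintZ (c : R) f : tint f -> tint (fun x => c * f x).
Proof.
by move=> hf; have := integrableZl measurableT c hf; apply: eq_integrable.
Qed.

Lemma tintM f g (B : R) :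
  tint f -> measurable_fun setT g -> (forall x, `|g x| <= B) ->
  tint (fun x => f x * g x).
Proof.
move=> hf mg gB; have bg : [bounded g x | x in [set: pt3 R]].
  exists B; split; first exact: num_real.
  by move=> M M1 x _ /=; rewrite (le_trans _ (ltW M1)).
by have := integrableMl measurableT hf mg bg; apply: eq_integrable.
Qed.

Lemma tint_sum (I : Type) (s : seq I) (F : I -> pt3 R -> R) :
  (forall i, tint (F i)) -> tint (fun x => \sum_(i <- s) F i x).
Proof.
move=> hF; elim: s => [|i s IH].
  by under eq_fun do rewrite big_nil; exact: integrable0.
under eq_fun do rewrite big_cons.
exact: tintD.
Qed.

Lemma Rintegral_sum (I : Type) (s : seq I) (F : I -> pt3 R -> R) :
  (forall i, tint (F i)) ->
  \int[torus_measure]_x (\sum_(i <- s) F i x)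
  = \sum_(i <- s) \int[torus_measure]_x F i x.
Proof.
move=> hF; elim: s => [|i s IH].
  under eq_Rintegral do rewrite big_nil.
  by rewrite big_nil Rintegral_cst// mul0r.
under eq_Rintegral do rewrite big_cons.
by rewrite RintegralD// ?IH ?big_cons//; exact: tint_sum.
Qed.

Lemma continuous_phase xi : continuous (phase xi : pt3 R -> R).
Proof.
move=> x; rewrite (_ : phase xi = fun x : pt3 R => (xi 0 0)%:~R * x.1.1
   + (xi 0 1)%:~R * x.1.2 + (xi 0 2%:R)%:~R * x.2); last first.
  by apply/funext => y; exact: phaseE.
apply: cvgD; [apply: cvgD|]; apply: cvgM; try exact: cvg_cst.
- by apply: (cvg_comp fst fst); exact: cvg_fst.
- by apply: (cvg_comp fst snd); [exact: cvg_fst|exact: cvg_snd].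
- exact: cvg_snd.
Qed.

Lemma measurable_phase xi : measurable_fun setT (phase xi : pt3 R -> R).
Proof.
rewrite (_ : phase xi = fun x : pt3 R => (xi 0 0)%:~R * x.1.1
   + (xi 0 1)%:~R * x.1.2 + (xi 0 2%:R)%:~R * x.2); last first.
  by apply/funext => y; exact: phaseE.
apply: measurable_funD; [apply: measurable_funD|]; apply: measurable_funM => //.
- by apply: (measurableT_comp measurable_fst); exact: measurable_fst.
- by apply: (measurableT_comp measurable_snd); exact: measurable_fst.
Qed.

Lemma measurable_cos_phase xi :
  measurable_fun setT (fun x : pt3 R => cos (phase xi x)).
Proof. exact: (measurableT_comp measurable_cos (measurable_phase xi)). Qed.

Lemma measurable_sin_phase xi :
  measurable_fun setT (fun x : pt3 R => sin (phase xi x)).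
Proof.
have ms : measurable_fun setT (@sin R).
  by apply: continuous_measurable_fun; exact: continuous_sin.
exact: (measurableT_comp ms (measurable_phase xi)).
Qed.

Lemma normr_cos_le1 (x : R) : `|cos x| <= 1.
Proof. by rewrite ler_norml cos_geN1 cos_le1. Qed.

Lemma normr_sin_le1 (x : R) : `|sin x| <= 1.
Proof. by rewrite ler_norml sin_geN1 sin_le1. Qed.

Lemma tint_cos xi : tint (fun x : pt3 R => cos (phase xi x)).
Proof.
apply: (@tint_bounded _ 1) => [|x]; last exact: normr_cos_le1.
exact: measurable_cos_phase.
Qed.

Lemma tint_sin xi : tint (fun x : pt3 R => sin (phase xi x)).
Proof.
apply: (@tint_bounded _ 1) => [|x]; last exact: normr_sin_le1.
exact: measurable_sin_phase.
Qed.

(** The arbitrary shift in torus_integral_cos covers the sine too. *)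
Lemma torus_integral_sin xi : \int[torus_measure]_x sin (phase xi x : R) = 0.
Proof.
under eq_Rintegral do rewrite -[sin _]opprK -cosDpihalf -mulN1r.
rewrite RintegralZl//; last first.
  apply: (@tint_bounded _ 1) => [|x]; last exact: normr_cos_le1.
  apply: (measurableT_comp measurable_cos); apply: measurable_funD => //.
  exact: measurable_phase.
by rewrite torus_integral_cos cos_pihalf mulr0 if_same mulr0.
Qed.

Lemma phaseD xi eta (x : pt3 R) : phase (xi + eta) x = phase xi x + phase eta x.
Proof. by rewrite !phaseE !mxE !intrD; ring. Qed.

Lemma phaseN xi (x : pt3 R) : phase (- xi) x = - phase xi x.
Proof. by rewrite !phaseE !mxE !mulrNz; ring. Qed.

Lemma integral_cos_cos xi eta :
  \int[torus_measure]_x (cos (phase xi x : R) * cos (phase eta x))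
  = (2 * pi) ^+ 3 / 2 * ((xi == eta)%:R + (xi == - eta)%:R).
Proof.
have cc (a b : R) : cos a * cos b = 2^-1 * cos (a - b) + 2^-1 * cos (a + b).
  by rewrite !cosD cosN sinN; field.
under eq_Rintegral do rewrite cc -phaseN -!phaseD.
rewrite RintegralD//; try by apply: tintZ; exact: tint_cos.
rewrite !RintegralZl//; try exact: tint_cos.
have E zeta :
    \int[torus_measure]_x cos (phase zeta x : R) = (2 * pi) ^+ 3 * (zeta == 0)%:R.
  under eq_Rintegral do rewrite -[phase _ _]addr0.
  by rewrite torus_integral_cos cos0 mulr1; case: ifP; rewrite ?mulr1 ?mulr0.
by rewrite !E subr_eq0 addr_eq0; field.
Qed.

Lemma integral_cos_sin xi eta :
  \int[torus_measure]_x (cos (phase xi x : R) * sin (phase eta x)) = 0.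
Proof.
have cs (a b : R) : cos a * sin b = 2^-1 * sin (a + b) + 2^-1 * sin (b - a).
  by rewrite !sinD cosN sinN; field.
under eq_Rintegral do rewrite cs -phaseN -!phaseD.
rewrite RintegralD//; try by apply: tintZ; exact: tint_sin.
rewrite !RintegralZl//; try exact: tint_sin.
by rewrite !torus_integral_sin mulr0 addr0.
Qed.

(** For m even, the convolution kernel of the multiplier m(D), at the origin. *)
Definition kernel (m : freq -> R) (M : nat) (x : pt3 R) : R :=
  \sum_(xi <- box M) m xi * cos (phase xi x).

Lemma kernel_measurable m M : measurable_fun setT (kernel m M).
Proof.
rewrite /kernel; elim: (box M) => [|i s IH].
  by under eq_fun do rewrite big_nil; exact: measurable_cst.
under eq_fun do rewrite big_cons.
by apply: measurable_funD => //; apply: measurable_funM => //; exact: measurable_cos_phase.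
Qed.

Lemma kernel_bounded m M x : `|kernel m M x| <= \sum_(xi <- box M) `|m xi|.
Proof.
rewrite (le_trans (ler_norm_sum _ _ _))//; apply: ler_sum => xi _.
by rewrite normrM ler_piMr// normr_cos_le1.
Qed.

Lemma tintM_kernel m M f : tint f -> tint (fun x => f x * kernel m M x).
Proof.
by move=> hf; apply: (tintM hf (kernel_measurable m M)) => x; exact: kernel_bounded.
Qed.

Lemma tintM_cos f xi : tint f -> tint (fun x => f x * cos (phase xi x)).
Proof.
move=> hf; apply: (tintM hf (@measurable_cos_phase xi)) => x; exact: normr_cos_le1.
Qed.

Lemma integralM_kernel m M f : tint f ->
  \int[torus_measure]_x (f x * kernel m M x)
  = \sum_(xi <- box M) m xi * \int[torus_measure]_x (f x * cos (phase xi x)).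
Proof.
move=> hf; under eq_Rintegral do rewrite mulr_sumr.
rewrite Rintegral_sum; last first.
  move=> xi; under eq_fun do rewrite mulrCA.
  by apply/tintZ/tintM_cos.
apply: eq_bigr => xi _; under eq_Rintegral do rewrite mulrCA.
by rewrite RintegralZl//; exact: tintM_cos.
Qed.

Definition even_on_box m M :=
  (forall xi, m (- xi) = m xi) /\ (forall xi, xi \notin box M -> m xi = 0).

Lemma sum_box_delta (F : freq -> R) M eta : (eta \notin box M -> F eta = 0) ->
  \sum_(xi <- box M) F xi * (eta == xi)%:R = F eta.
Proof.
move=> F0; case: (boolP (eta \in box M)) => [h|h].
  rewrite (bigD1_seq eta)//= ?uniq_box// eqxx mulr1 big1 ?addr0// => xi /negbTE xe.
  by rewrite eq_sym xe mulr0.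
rewrite F0// big_seq big1// => xi xb.
by case: eqP xb => [<-|]; rewrite ?mulr0// (negbTE h).
Qed.

(** Both frequencies eta and - eta of the kernel resonate with cos(eta.x), each
    with weight 1/2; evenness of m turns the sum into m(eta). *)
Lemma integral_cos_kernel m M eta : even_on_box m M ->
  \int[torus_measure]_x (cos (phase eta x) * kernel m M x)
  = (2 * pi) ^+ 3 * m eta.
Proof.
move=> [me m0]; rewrite integralM_kernel; last exact: tint_cos.
under eq_bigr => xi _ do rewrite integral_cos_cos mulrCA (mulrDr (m xi)).
rewrite -mulr_sumr big_split /= sum_box_delta//; last exact: m0.
under [X in _ + X]eq_bigr do rewrite -(eqr_opp eta) opprK.
by rewrite sum_box_delta ?opp_box ?me//; [field|exact: m0].
Qed.

Lemma integral_sin_kernel m M eta :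
  \int[torus_measure]_x (sin (phase eta x) * kernel m M x) = 0.
Proof.
rewrite integralM_kernel; last exact: tint_sin.
apply: big1 => xi _; under eq_Rintegral do rewrite mulrC.
by rewrite integral_cos_sin mulr0.
Qed.

Lemma tint_kernel m M : tint (kernel m M).
Proof.
by apply: tint_bounded; [exact: kernel_measurable|exact: kernel_bounded].
Qed.

Lemma integral_kernel_sqr m M : even_on_box m M ->
  \int[torus_measure]_x (kernel m M x ^+ 2)
  = (2 * pi) ^+ 3 * \sum_(xi <- box M) m xi ^+ 2.
Proof.
move=> hm; under eq_Rintegral do rewrite expr2.
rewrite integralM_kernel; last exact: tint_kernel.
rewrite mulr_sumr; apply: eq_bigr => xi _.
under eq_Rintegral do rewrite mulrC.
by rewrite integral_cos_kernel// expr2; ring.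
Qed.

End Kernel.

(** * Trigonometric polynomials *)

Section Synthesis.
Context {R : realType}.
Implicit Types (c : freq -> 'rV[R[i]]_3) (m : freq -> R).

Definition supported c N := forall xi, xi \notin box N -> c xi = 0.

Lemma synthesisE c N k (x : pt3 R) : supported c N ->
  synthesis c x 0 k = \sum_(xi <- box N)
    (complex.Re (c xi 0 k) * cos (phase xi x)
     - complex.Im (c xi 0 k) * sin (phase xi x)).
Proof.
move=> c0; rewrite /synthesis mxE (@fsum_box _ N); last first.
  by move=> xi h; rewrite c0// scaler0.
rewrite summxE (raddf_sum (@complex.Re R : {additive Rcomplex R -> R})).
apply: eq_bigr => xi _; rewrite mxE.
by case: (c xi 0 k) => a b /=; ring.
Qed.

Lemma tint_synthesis c N k : supported c N -> tint (fun x => synthesis c x 0 k).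
Proof.
move=> c0; under eq_fun do rewrite (synthesisE _ _ c0).
apply: tint_sum => xi; apply: tintB; apply: tintZ.
  exact: tint_cos.
exact: tint_sin.
Qed.

(** The imaginary parts of the coefficients multiply sines, which are orthogonal
    to the kernel. *)
Lemma integral_synthesis_kernel c N m M k : supported c N -> even_on_box m M ->
  \int[torus_measure]_x (synthesis c x 0 k * kernel m M x)
  = (2 * pi) ^+ 3 * \sum_(xi <- box N) m xi * complex.Re (c xi 0 k).
Proof.
move=> c0 hm; under eq_Rintegral do rewrite (synthesisE _ _ c0) mulr_suml.
have ti xi : tint (fun x : pt3 R => cos (phase xi x) * kernel m M x).
  by apply: tintM_kernel; exact: tint_cos.
have si xi : tint (fun x : pt3 R => sin (phase xi x) * kernel m M x).
  by apply: tintM_kernel; exact: tint_sin.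
rewrite Rintegral_sum; last first.
  move=> xi; under eq_fun do rewrite mulrBl -!mulrA.
  by apply: tintB; apply: tintZ.
rewrite mulr_sumr; apply: eq_bigr => xi _.
under eq_Rintegral do rewrite mulrBl -!mulrA.
rewrite RintegralB//; try exact: tintZ.
rewrite !RintegralZl// integral_cos_kernel// integral_sin_kernel; ring.
Qed.

Lemma phase_at0 xi : phase xi (0 : pt3 R) = 0.
Proof. by rewrite phaseE !mulr0 !addr0. Qed.

Lemma synthesis_at0 c N k : supported c N ->
  synthesis c 0 0 k = \sum_(xi <- box N) complex.Re (c xi 0 k).
Proof.
move=> c0; rewrite (synthesisE _ _ c0); apply: eq_bigr => xi _.
by rewrite phase_at0 cos0 sin0 mulr1 mulr0 subr0.
Qed.

Lemma continuous_synthesis c N k : supported c N ->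
  continuous (fun x => synthesis c x 0 k : R).
Proof.
move=> c0; pose F xi (x : pt3 R) : R :=
  complex.Re (c xi 0 k) * cos (phase xi x)
  - complex.Im (c xi 0 k) * sin (phase xi x).
rewrite (_ : (fun x => _) = fun x => \sum_(xi <- box N) F xi x); last first.
  by apply/funext => x; exact: synthesisE.
have cF xi : continuous (F xi).
  move=> x; apply: cvgB; apply: cvgM; try exact: cvg_cst.
  - by apply: continuous_comp; [exact: continuous_phase|exact: continuous_cos].
  - by apply: continuous_comp; [exact: continuous_phase|exact: continuous_sin].
elim: (box N) => [|xi s IH] x.
  rewrite (_ : (fun x => _) = cst 0); first exact: cvg_cst.
  by apply/funext => y; rewrite big_nil.
rewrite (_ : (fun x => _) = F xi \+ (fun x => \sum_(xi <- s) F xi x)).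
  by apply: cvgD; [exact: cF|exact: IH].
by apply/funext => y; rewrite big_cons.
Qed.

Lemma circle_measure_itv (r : R) : 0 < r -> r <= 2 * pi ->
  circle_measure (`[0, r[%classic : set (measurableTypeR R)) = r%:E.
Proof.
move=> r0 r2; rewrite circle_measureE setIidl; last first.
  by apply: subset_itvl; rewrite bnd_simp.
by rewrite lebesgue_measure_itv/= lte_fin r0 -EFinB subr0.
Qed.

(** The fundamental cell is [0, 2 pi[^3, so that the origin is a corner of it:
    a neighbourhood contains a cube [0, r[^3, of measure r^3. *)
Lemma torus_measure_nbhs0 (A : set (pt3 R)) :
  nbhs (0 : pt3 R) A -> measurable A ->
  (0 < torus_measure A)%E.
Proof.
move=> /nbhs_ballP[e/= e0 eA] mA.
pose r := Num.min e (2 * pi).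
have pi0 : 0 < 2 * pi :> R by rewrite mulr_gt0 ?pi_gt0.
have r0 : 0 < r by rewrite lt_min e0 pi0.
have rpi : r <= 2 * pi by rewrite ge_min lexx orbT.
pose I := `[0, r[%classic : set (measurableTypeR R).
have mI : measurable I by exact: measurable_itv.
have IA : (I `*` I) `*` I `<=` A.
  move=> [[x y] z] [[/= hx hy] hz]; apply: eA.
  have H t : I t -> ball (0 : R) e t.
    rewrite /I /= in_itv/= => /andP[t0 tr]; rewrite /ball /= sub0r normrN ger0_norm//.
    by rewrite (lt_le_trans tr)// ge_min lexx.
  by split; [split|]; exact: H.
have : (torus_measure ((I `*` I) `*` I) <= torus_measure A)%E.
  by apply: le_measure; rewrite ?inE//; apply: measurableX => //; exact: measurableX.
apply: lt_le_trans.
have cI : circle_measure I = r%:E by exact: circle_measure_itv.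
have -> : torus_measure ((I `*` I) `*` I) = ((r%:E * r%:E) * r%:E)%E.
  rewrite [LHS](product_measure1E (@torus2_measure R))//; last exact: measurableX.
  congr (_ * _)%E; last exact: cI.
  by rewrite [LHS](product_measure1E (@circle_measure R))//; congr (_ * _)%E; exact: cI.
by rewrite -!EFinM lte_fin !mulr_gt0.
Qed.

Lemma le_enorm (v : 'rV[R]_3) k : `|v 0 k| <= enorm v.
Proof.
rewrite /enorm -sqrtr_sqr ler_wsqrtr// (bigD1 k)//= lerDl.
by apply: sumr_ge0 => i _; exact: sqr_ge0.
Qed.

Lemma torus_measure_gt0 : (0 < torus_measure [set: pt3 R])%E.
Proof. by apply: torus_measure_nbhs0 => //; exact: filterT. Qed.

(** By continuity, exceeding D at 0 would mean exceeding D on a neighbourhood of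
    0, which is not negligible. *)
Lemma synthesis_at0_le c N k (D : R) : supported c N ->
  (Lp_norm +oo (synthesis c) <= D%:E)%E -> `|synthesis c 0 0 k| <= D.
Proof.
move=> c0; rewrite /Lp_norm unlock torus_measure_gt0 => /ess_supP hD.
rewrite leNgt; apply/negP => hlt.
have cs : (fun x => `|synthesis c x 0 k|) @ (0 : pt3 R) --> `|synthesis c 0 0 k|.
  by apply: cvg_norm; exact: (continuous_synthesis (k := k) c0).
have : \forall x \near (0 : pt3 R), D < `|synthesis c x 0 k|.
  exact: (cvgr_gt _ cs).
move=> hn.
case: hD => N0 [mN0 N00 subN0].
have : nbhs (0 : pt3 R) N0.
  apply: filterS hn => x hx; apply: subN0 => /= hle; move: hle.
  rewrite lee_fin ger0_norm ?sqrtr_ge0// => hle.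
  by have := lt_le_trans hx (le_trans (le_enorm _ _) hle); rewrite ltxx.
by move=> /torus_measure_nbhs0 /(_ mN0); rewrite N00 ltxx.
Qed.

End Synthesis.

(** * Pairs of consecutive Littlewood-Paley blocks *)

Section LP.
Context {R : realType}.
Context (chi : R -> R) (hchi : LP_cutoff chi).
Implicit Types (xi : freq).

(** The Euclidean length |xi|. *)
Definition rho xi : R := enorm (freqR xi).

Lemma rho_ge0 xi : 0 <= rho xi. Proof. exact: sqrtr_ge0. Qed.

Lemma rho_sqr xi : rho xi ^+ 2 = \sum_k (xi 0 k)%:~R ^+ 2.
Proof.
rewrite sqr_sqrtr; last by apply: sumr_ge0 => k _; exact: sqr_ge0.
by apply: eq_bigr => k _; rewrite mxE.
Qed.

Lemma rho_opp xi : rho (- xi) = rho xi.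
Proof.
rewrite /rho /enorm; congr Num.sqrt; apply: eq_bigr => k _.
by rewrite !mxE mulrNz sqrrN.
Qed.

Lemma rho_notin_box M xi : xi \notin box M -> (M%:R : R) <= rho xi.
Proof.
rewrite mem_box negb_forall => /existsP[k]; rewrite -ltNge => h.
apply: le_trans (le_enorm _ k); rewrite mxE.
rewrite -intr_norm (_ : M%:R = (M%:Z)%:~R :> R)// ler_int; exact: ltW.
Qed.

Lemma LP_symbol_opp q xi : LP_symbol chi q (- xi) = LP_symbol chi q xi.
Proof. by rewrite /LP_symbol -!/(rho _) rho_opp. Qed.

Lemma LP_symbolS q xi :
  LP_symbol chi q.+1 xi = chi (rho xi / 2 ^+ q.+2) - chi (rho xi / 2 ^+ q.+1).
Proof. by rewrite /LP_symbol /lambda -PoszD addn1. Qed.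

Lemma chi_eq0 r : 1 <= r -> chi r = 0. Proof. by case: hchi => _ _ _; apply. Qed.
Lemma chi_eq1 r : r <= 2^-1 -> chi r = 1. Proof. by case: hchi => _ _ + _; apply. Qed.
Lemma chi_bound r : 0 <= chi r <= 1. Proof. by case: hchi => _ + _ _; apply. Qed.

Lemma LP_symbol_supp q M xi : (2 ^ q.+2 <= M)%N -> xi \notin box M ->
  LP_symbol chi q.+1 xi = 0.
Proof.
move=> hM /rho_notin_box h; rewrite LP_symbolS.
have h2 : 2 ^+ q.+2 <= rho xi by rewrite (le_trans _ h)// -natrX ler_nat.
rewrite !chi_eq0 ?subrr// ler_pdivlMr ?exprn_gt0// mul1r//.
by rewrite (le_trans _ h2)// ler_eXn2l// ltr1n.
Qed.

(** With lambda = 2^(p+2), this is the symbol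
    chi(|xi| / (2 lambda)) - chi(2 |xi| / lambda), supported in
    lambda/4 < |xi| < 2 lambda. *)
Definition LP_pair p xi := LP_symbol chi p.+1 xi + LP_symbol chi p.+2 xi.

Lemma LP_pairE p xi :
  LP_pair p xi = chi (rho xi / 2 ^+ p.+3) - chi (rho xi / 2 ^+ p.+1).
Proof. by rewrite /LP_pair !LP_symbolS addrC addrA subrK. Qed.

Lemma LP_pair_even p M : (2 ^ p.+3 <= M)%N -> even_on_box (LP_pair p) M.
Proof.
move=> hM; have hM' : (2 ^ p.+2 <= M)%N by rewrite (leq_trans _ hM)// leq_exp2l.
split=> xi; rewrite /LP_pair ?LP_symbol_opp// => h.
by rewrite !(@LP_symbol_supp _ M)// addr0.
Qed.

(** If |xi| <= lambda, the first value of chi in the telescoped symbol is 1; if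
    |xi| > lambda, the second is 0. *)
Lemma LP_pair_bound p xi : 0 <= LP_pair p xi <= 1.
Proof.
rewrite LP_pairE; have /andP[a0 a1] := chi_bound (rho xi / 2 ^+ p.+3).
have /andP[b0 b1] := chi_bound (rho xi / 2 ^+ p.+1).
have L0 : 0 < 2 ^+ p.+2 :> R by rewrite exprn_gt0.
case: (leP (rho xi) (2 ^+ p.+2)) => h; last first.
  rewrite (chi_eq0 (r := rho xi / 2 ^+ p.+1)); last first.
    rewrite ler_pdivlMr ?exprn_gt0// mul1r (le_trans _ (ltW h))//.
    by rewrite ler_eXn2l// ltr1n.
  by rewrite subr0 a0.
rewrite (chi_eq1 (r := rho xi / 2 ^+ p.+3)); first by apply/andP; split; lra.
by rewrite exprS invfM mulrCA ger_pMr ?invr_gt0// ler_pdivrMr ?mul1r.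
Qed.

Lemma LP_pair_eq1 p xi : 2 ^+ p.+1 <= rho xi <= 2 ^+ p.+2 -> LP_pair p xi = 1.
Proof.
move=> /andP[h1 h2]; rewrite LP_pairE chi_eq1; last first.
  by rewrite exprS invfM mulrCA ger_pMr ?invr_gt0// ler_pdivrMr ?mul1r// exprn_gt0.
by rewrite chi_eq0 ?subr0// ler_pdivlMr ?exprn_gt0// mul1r.
Qed.

Lemma LP_pair_neq0 p xi : LP_pair p xi != 0 -> 2 ^+ p < rho xi.
Proof.
apply: contraNT; rewrite -leNgt => h; rewrite LP_pairE.
have h3 : rho xi <= 2 ^+ p.+2.
  by rewrite (le_trans h)// ler_eXn2l ?ltr1n// -addn2 leq_addr.
rewrite !chi_eq1 ?subrr//.
  by rewrite exprS invfM mulrCA ger_pMr ?invr_gt0// ler_pdivrMr ?mul1r// exprn_gt0.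
by rewrite exprS invfM mulrCA ger_pMr ?invr_gt0// ler_pdivrMr ?mul1r// exprn_gt0.
Qed.

Lemma ReCmul (a : R) (z : R[i]) : complex.Re (a%:C * z) = a * complex.Re z.
Proof. by case: z => x y /=; rewrite mul0r subr0. Qed.

Lemma LP_block_at0 q M (w : pt3 R -> 'rV[R]_3) k : (2 ^ q.+2 <= M)%N ->
  tint (fun x => w x 0 k) ->
  LP_block chi q.+1 w 0 0 k
  = (2 * pi) ^- 3
    * \int[torus_measure]_x (w x 0 k * kernel (LP_symbol chi q.+1) M x).
Proof.
move=> hM hw; rewrite /LP_block (@synthesis_at0 _ _ M); last first.
  by move=> xi h; rewrite (LP_symbol_supp hM h) scale0r.
rewrite integralM_kernel// mulr_sumr; apply: eq_bigr => xi _.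
by rewrite !mxE ReCmul /= mulrCA.
Qed.

(** How the Besov norm is used: bounds on two consecutive blocks bound the
    pairing with the sum of their kernels. *)
Lemma LP_pair_pairing p M (w : pt3 R -> 'rV[R]_3) k (D1 D2 : R) :
  (2 ^ p.+3 <= M)%N ->
  tint (fun x => w x 0 k) ->
  (Lp_norm +oo (LP_block chi p.+1 w) <= D1%:E)%E ->
  (Lp_norm +oo (LP_block chi p.+2 w) <= D2%:E)%E ->
  `|\int[torus_measure]_x (w x 0 k * kernel (LP_pair p) M x)|
  <= (2 * pi) ^+ 3 * (D1 + D2).
Proof.
move=> hM hw h1 h2.
have hM' : (2 ^ p.+2 <= M)%N by rewrite (leq_trans _ hM)// leq_exp2l.
have pi0 : 0 < (2 * pi) ^+ 3 :> R by rewrite exprn_gt0// mulr_gt0 ?pi_gt0.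
have sup q : (2 ^ q.+2 <= M)%N ->
    supported (fun xi => (LP_symbol chi q.+1 xi)%:C *: fourierv w xi) M.
  by move=> hq xi h; rewrite (LP_symbol_supp hq h) scale0r.
have := synthesis_at0_le k (sup _ hM') h1.
rewrite -/(LP_block _ _ _) (LP_block_at0 hM' hw) => a1.
have := synthesis_at0_le k (sup _ hM) h2.
rewrite -/(LP_block _ _ _) (LP_block_at0 hM hw) => a2.
have -> : \int[torus_measure]_x (w x 0 k * kernel (LP_pair p) M x) =
   \int[torus_measure]_x (w x 0 k * kernel (LP_symbol chi p.+1) M x)
   + \int[torus_measure]_x (w x 0 k * kernel (LP_symbol chi p.+2) M x).
  rewrite !integralM_kernel// -big_split /=; apply: eq_bigr => xi _.
  by rewrite -mulrDl.
have n3 : `|(2 * pi) ^- 3| = (2 * pi) ^- 3 :> R by rewrite ger0_norm// invr_ge0 ltW.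
move: a1 a2.
rewrite [X in X <= D1 -> _]normrM [X in _ -> X <= D2 -> _]normrM n3.
rewrite !ler_pdivrMl// => a1 a2.
by rewrite (le_trans (ler_normD _ _))// mulrDr lerD.
Qed.

End LP.

(** * Blocks of a field in H^1 *)

Section H1.
Context {R : realType}.
Implicit Types (xi : freq) (f g : pt3 R -> R).

Lemma Lfun2_tint f : f \in Lfun torus_measure 2%:E -> tint f.
Proof.
move=> hf; apply/Lfun1_integrable; apply: Lfun_subset12 hf.
exact: torus_measure_fin measurableT.
Qed.

(** The Cauchy-Schwarz inequality in its additive form: the free parameter s
    balances the two integrals.  It is a large constant in the H^1 estimate, and
    inversely proportional to the L^2 error in the approximation of U by its
    partial sums. *)
Lemma integral_young f g (s : R) : 0 < s ->
  tint (fun x => f x ^+ 2) -> tint (fun x => f x * g x) ->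
  tint (fun x => g x ^+ 2) ->
  `|\int[torus_measure]_x (f x * g x)|
  <= 2^-1 * (s * \int[torus_measure]_x (f x ^+ 2)
             + s^-1 * \int[torus_measure]_x (g x ^+ 2)).
Proof.
move=> s0 hf hfg hg.
have hL : tint (fun x => s * f x ^+ 2) by exact: tintZ.
have hR : tint (fun x => s^-1 * g x ^+ 2) by exact: tintZ.
apply: le_trans (le_normr_Rintegral _ hfg) _ => //.
rewrite -!RintegralZl// -RintegralD// -RintegralZl//; last exact: tintD.
apply: le_Rintegral => //.
- by have := integrable_abse hfg; apply: eq_integrable.
- by apply: tintZ; exact: tintD.
move=> x _; set a := f x; set b := g x.
rewrite ler_norml.
have e1 : 0 <= s^-1 * (s * a + b) ^+ 2 by rewrite mulr_ge0 ?sqr_ge0// invr_ge0 ltW.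
have e2 : 0 <= s^-1 * (s * a - b) ^+ 2 by rewrite mulr_ge0 ?sqr_ge0// invr_ge0 ltW.
have sn : s != 0 by rewrite gt_eqF.
have E1 :
    s^-1 * (s * a + b) ^+ 2 = s * a ^+ 2 + s^-1 * b ^+ 2 + 2 * (a * b) by field.
have E2 :
    s^-1 * (s * a - b) ^+ 2 = s * a ^+ 2 + s^-1 * b ^+ 2 - 2 * (a * b) by field.
rewrite E1 in e1; rewrite E2 in e2.
by apply/andP; split; lra.
Qed.

Lemma tint_kernel_sqr m M : tint (fun x : pt3 R => kernel m M x ^+ 2).
Proof.
under eq_fun do rewrite expr2.
by apply: tintM_kernel; exact: tint_kernel.
Qed.

Lemma multiplier_integral_cos (mm : freq -> R) (u g : pt3 R -> 'rV[R]_3) k xi :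
  is_multiplier mm u g ->
  \int[torus_measure]_x (g x 0 k * cos (phase xi x))
  = mm xi * \int[torus_measure]_x (u x 0 k * cos (phase xi x)).
Proof.
move=> /(_ xi) /rowP /(_ k) /(congr1 (@complex.Re R)).
rewrite !mxE ReCmul /= mulrCA => /mulfI; apply.
by rewrite invr_eq0 gt_eqF// exprn_gt0// mulr_gt0 ?pi_gt0.
Qed.

(** The symbol of (1 - Delta)^(1/2), as in H1_norm. *)
Definition bessel xi : R := Num.sqrt (1 + enorm (freqR xi) ^+ 2).

Lemma bessel_gt0 xi : 0 < bessel xi.
Proof. by rewrite sqrtr_gt0 ltr_pwDl// sqr_ge0. Qed.

Lemma rho_le_bessel xi : rho xi <= bessel xi.
Proof.
by rewrite -[rho xi]ger0_norm ?rho_ge0// -sqrtr_sqr ler_wsqrtr// lerDr.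
Qed.

Lemma bessel_opp xi : bessel (- xi) = bessel xi.
Proof. by rewrite /bessel -!/(rho _) rho_opp. Qed.

Context (chi : R -> R) (hchi : LP_cutoff chi).

(** Every term is at most (lambda/4)^-2, and a cube of side 4 lambda contains at
    most (17 lambda/4)^3 frequencies; 17^3 <= 2^13. *)
Lemma sum_LP_pair_bessel p :
  \sum_(xi <- box (2 ^ p.+3)) (LP_pair chi p xi / bessel xi) ^+ 2
  <= 2 ^+ 11 * 2 ^+ p.+2 :> R.
Proof.
have L0 : 0 < 2 ^+ p :> R by rewrite exprn_gt0.
have T xi : (LP_pair chi p xi / bessel xi) ^+ 2 <= (2 ^+ p) ^- 2.
  have [->|h] := eqVneq (LP_pair chi p xi) 0.
    by rewrite mul0r expr0n /= invr_ge0 exprn_ge0// ltW.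
  have /andP[m0 m1] := LP_pair_bound hchi p xi.
  have hb : 2 ^+ p <= bessel xi.
    by rewrite (le_trans _ (rho_le_bessel xi))// ltW// (LP_pair_neq0 hchi h).
  have b0 : 0 <= (bessel xi)^-1 by rewrite invr_ge0 ltW// bessel_gt0.
  rewrite -exprVn; apply: lerXn2r; rewrite ?nnegrE.
  - exact: mulr_ge0.
  - by rewrite invr_ge0 ltW.
  - by rewrite -[leRHS]mul1r ler_pM// lef_pV2 ?posrE ?bessel_gt0.
apply: (@le_trans _ _ (\sum_(xi <- box (2 ^ p.+3)) (2 ^+ p) ^- 2)).
  by apply: ler_sum => xi _.
rewrite big_const_seq count_predT size_box iter_addr_0 -[leLHS]mulr_natr.
have -> : ((2 * 2 ^ p.+3).+1 ^ 3)%:R = (16 * 2 ^+ p + 1) ^+ 3 :> R.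
  by rewrite natrX; congr (_ ^+ 3); rewrite -addn1 natrD natrM natrX !exprS; ring.
have -> : 2 ^+ p.+2 = 4 * 2 ^+ p :> R by rewrite !exprS; ring.
have L1 : 1 <= 2 ^+ p :> R by rewrite exprn_ege1// ler1n.
set L : R := 2 ^+ p in L0 L1 *; rewrite ler_pdivrMl ?exprn_gt0//.
apply: (@le_trans _ _ ((17 * L) ^+ 3)).
  by apply: lerXn2r; rewrite ?nnegrE; lra.
have L3 : 0 <= L ^+ 3 by rewrite exprn_ge0// ltW.
have -> : (17 * L) ^+ 3 = 17 ^+ 3 * L ^+ 3 by rewrite exprMn.
have -> : L ^+ 2 * (2 ^+ 11 * (4 * L)) = 2 ^+ 13 * L ^+ 3.
  by rewrite (exprD 2 11 2); ring.
by rewrite ler_wpM2r// -!natrX ler_nat.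
Qed.

(** With g = (1 - Delta)^(1/2) u and s a constant, the right-hand side grows like
    lambda / s while the pairing with U grows like lambda^(2 alpha - 1). *)
Lemma H1_pairing p (u g : pt3 R -> 'rV[R]_3) k (s : R) : 0 < s ->
  L2 g -> is_multiplier bessel u g -> tint (fun x => u x 0 k) ->
  `|\int[torus_measure]_x (u x 0 k * kernel (LP_pair chi p) (2 ^ p.+3) x)|
  <= 2^-1 * (s * \int[torus_measure]_x (g x 0 k ^+ 2)
             + s^-1 * ((2 * pi) ^+ 3 * (2 ^+ 11 * 2 ^+ p.+2))).
Proof.
move=> s0 hg hug hu; set M := (2 ^ p.+3)%N.
pose a xi := LP_pair chi p xi / bessel xi.
have gi : tint (fun x => g x 0 k) by exact: Lfun2_tint.
have -> : \int[torus_measure]_x (u x 0 k * kernel (LP_pair chi p) M x)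
        = \int[torus_measure]_x (g x 0 k * kernel a M x).
  rewrite !integralM_kernel//; apply: eq_bigr => xi _.
  by rewrite (multiplier_integral_cos _ _ hug) mulrA divfK// gt_eqF// bessel_gt0.
apply: le_trans (integral_young s0 _ _ _) _.
- exact: Lfun2_integrable_sqr.
- exact: tintM_kernel.
- exact: tint_kernel_sqr.
rewrite ler_pM2l// lerD2l ler_pM2l ?invr_gt0// integral_kernel_sqr.
  by rewrite ler_pM2l ?sum_LP_pair_bessel// exprn_gt0// mulr_gt0 ?pi_gt0.
have [pe p0] := LP_pair_even hchi (leqnn M).
by split=> xi; rewrite /a ?bessel_opp ?pe// => /p0 ->; rewrite mul0r.
Qed.

End H1.

(** * Fourier coefficients of the initial field *)

Section HatU.
Context {R : realType}.
Implicit Types (xi : freq) (q : nat).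

Lemma rho_eq0 xi : (@rho R xi == 0) = (xi == 0).
Proof.
apply/eqP/eqP => [h|->]; last first.
  by rewrite /rho /enorm big1 ?sqrtr0// => k _; rewrite !mxE expr0n.
apply/rowP => k; rewrite mxE; have := le_enorm (freqR xi : 'rV[R]_3) k.
by rewrite -/(rho xi) h mxE normr_le0 intr_eq0 => /eqP.
Qed.

Lemma evecE (k j : 'I_3) xi :
  complex.Re (evec k xi 0 j : R[i]) = if xi == 0 then (k == j)%:R
    else (k == j)%:R - rho xi ^- 2 * ((xi 0 k)%:~R * (xi 0 j)%:~R).
Proof.
rewrite /evec mxE /= -rowE mxE /leray; case: eqP => _; rewrite !mxE//.
by rewrite big_ord1 !mxE.
Qed.

Lemma Im_evec (k j : 'I_3) xi : complex.Im (evec k xi 0 j : R[i]) = 0.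
Proof. by rewrite /evec mxE. Qed.

Lemma Re_char_mul (S : set freq) xi (z : R[i]) :
  complex.Re (char_fun S xi * z) = \1_S xi * complex.Re z.
Proof. exact: ReCmul. Qed.

Variable alpha : R.

(** The coefficients on the blocks C_j are imaginary, whence the absence of C_j
    from this formula. *)
Lemma Re_hatU_top q xi k :
  complex.Re (hatU_top alpha q xi 0 k)
  = lambda q%:Z `^ (2 * alpha - 4) *
    (\1_(@blockA R q `|` reflected (@blockA R q)) xi *
      complex.Re (evec 1 xi 0 k : R[i])).
Proof.
rewrite /hatU_top; move: (Im_evec 1 k xi) (Im_evec 0 k xi).
move: (evec 1 xi) (evec 0 xi) => u v; rewrite !mxE ReCmul => hu hv; congr (_ * _).
case: (u 0 k) hu => a1 a2 /= ->; case: (v 0 k) hv => b1 b2 /= ->.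
rewrite /char_fun /=; ring.
Qed.

Lemma Re_hatU_sub q xi k :
  complex.Re (hatU_sub alpha q xi 0 k)
  = lambda q%:Z `^ (2 * alpha - 4) *
    (\1_(@blockB R q `|` reflected (@blockB R q)) xi *
      complex.Re (evec 0 xi 0 k : R[i])).
Proof.
by rewrite /hatU_sub; move: (evec 0 xi) => u; rewrite !mxE ReCmul Re_char_mul.
Qed.

Lemma lambdaE q : @lambda R q%:Z = 2 ^+ q. Proof. by []. Qed.
Lemma lambda_pred q : @lambda R (q%:Z - 1) = 2 ^+ q / 2.
Proof. by rewrite /lambda expfzDr ?expr1z// -exprz_inv. Qed.

Lemma box_of_bound N xi : (forall k, `|(xi 0 k)%:~R : R| <= N%:R) -> xi \in box N.
Proof.
move=> h; rewrite mem_box; apply/forallP => k; have := h k.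
by rewrite -intr_norm (_ : N%:R = (N%:Z)%:~R :> R)// ler_int.
Qed.

Lemma ord3P (P : 'I_3 -> Prop) : P 0 -> P 1 -> P 2%:R -> forall k, P k.
Proof.
move=> p0 p1 p2 k.
have : [\/ k = 0, k = 1 | k = 2%:R].
  by case: k => [[|[|[|//]]] hk]; [apply: Or31|apply: Or32|apply: Or33];
    apply: val_inj.
by case=> ->.
Qed.

Lemma blockA_bound q xi : @blockA R q xi ->
  forall k, `|(xi 0 k)%:~R : R| <= 11 / 10 * 2 ^+ q.
Proof.
have L0 : 0 < 2 ^+ q :> R by rewrite exprn_gt0.
case; rewrite !lambdaE !mxE !ler_norml.
by move=> /andP[h1 h2] /andP[h3 h5] /andP[h4 h6];
  apply: ord3P; rewrite ler_norml; lra.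
Qed.

Lemma blockB_bound q xi : @blockB R q xi ->
  forall k, `|(xi 0 k)%:~R : R| <= 6 / 10 * 2 ^+ q.
Proof.
have L0 : 0 < 2 ^+ q :> R by rewrite exprn_gt0.
case; rewrite !lambda_pred !mxE !ler_norml.
by move=> /andP[h1 h5] /andP[h2 h6] /andP[h3 h4];
  apply: ord3P; rewrite ler_norml; lra.
Qed.

Lemma reflectedE (S : set freq) xi : reflected S xi <-> S (- xi).
Proof.
by split=> [[eta Se <-]|h]; [rewrite opprK|exists (- xi); rewrite ?opprK].
Qed.

Lemma char_fun_eq0 (S : set freq) xi : ~ S xi -> char_fun S xi = 0 :> R[i].
Proof. by move=> h; rewrite /char_fun indicE memNset. Qed.

Lemma blocks_in_box q xi :
  (@blockA R q `|` reflected (@blockA R q)) xi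
  \/ (@blockC R q `|` reflected (@blockC R q)) xi
  \/ (@blockB R q `|` reflected (@blockB R q)) xi -> xi \in box (2 ^ q.+1).
Proof.
have L0 : 0 < 2 ^+ q :> R by rewrite exprn_gt0.
have N2 : (2 ^ q.+1)%:R = 2 * 2 ^+ q :> R by rewrite natrX exprS.
have bA eta : @blockA R q eta -> eta \in box (2 ^ q.+1).
  move=> /blockA_bound h; apply: box_of_bound => k.
  by rewrite N2 (le_trans (h k))//; lra.
have bB eta : @blockB R q eta -> eta \in box (2 ^ q.+1).
  move=> /blockB_bound h; apply: box_of_bound => k.
  by rewrite N2 (le_trans (h k))//; lra.
have bC eta : @blockC R q eta -> eta \in box (2 ^ q.+1).
  move=> [a /blockA_bound ha [b /blockB_bound hb <-]]; apply: box_of_bound => k.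
  rewrite mxE intrD N2 (le_trans (ler_normD _ _))//.
  by rewrite (le_trans (lerD (ha k) (hb k)))//; lra.
by move=> [[/bA|/reflectedE/bA]|[[/bC|/reflectedE/bC]|[/bB|/reflectedE/bB]]];
  rewrite ?opp_box.
Qed.

Lemma supported_top q : supported (@hatU_top R alpha q) (2 ^ q.+1).
Proof.
move=> xi /negP h; rewrite /hatU_top.
rewrite !char_fun_eq0 ?mulr0 ?scale0r ?addr0 ?subr0 ?scaler0//.
all: move=> h'; apply: h; apply: (@blocks_in_box q).
- by right; left; right.
- by right; left; left.
- by left.
Qed.

Lemma supported_sub q : supported (@hatU_sub R alpha q) (2 ^ q.+1).
Proof.
move=> xi /negP h; rewrite /hatU_sub char_fun_eq0 ?scale0r ?scaler0//.
by move=> h'; apply: h; apply: (@blocks_in_box q); right; right.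
Qed.

(** This reflection preserves |xi| and the blocks B_j, and changes the sign of
    the second component - xi_1 xi_2 / |xi|^2 of p(xi) e_1. *)
Definition flip1 xi : freq := \row_k (if k == 1 then - xi 0 k else xi 0 k).

Lemma flip1K : involutive flip1.
Proof. by move=> xi; apply/rowP => k; rewrite !mxE; case: eqP; rewrite ?opprK. Qed.

Lemma flip1_box M xi : (flip1 xi \in box M) = (xi \in box M).
Proof.
rewrite !mem_box; apply: eq_forallb => k.
by rewrite mxE; case: eqP; rewrite ?normrN.
Qed.

Lemma rho_flip1 xi : @rho R (flip1 xi) = rho xi.
Proof.
rewrite /rho /enorm; congr Num.sqrt; apply: eq_bigr => k _.
by rewrite !mxE; case: eqP => _//; rewrite mulrNz sqrrN.
Qed.

Lemma flip1_blockB q xi : @blockB R q xi -> @blockB R q (flip1 xi).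
Proof.
by case; rewrite !mxE /= => h1 h2 h3; split; rewrite !mxE //= mulrNz normrN.
Qed.

Lemma flip1_blockBs q xi : (@blockB R q `|` reflected (@blockB R q)) xi ->
  (@blockB R q `|` reflected (@blockB R q)) (flip1 xi).
Proof.
case=> [h|/reflectedE h]; [left|right]; first exact: flip1_blockB.
apply/reflectedE; rewrite (_ : - flip1 xi = flip1 (- xi)); first exact: flip1_blockB.
by apply/rowP => k; rewrite !mxE; case: eqP.
Qed.

Lemma flip1_indicB q xi :
  \1_(@blockB R q `|` reflected (@blockB R q)) (flip1 xi)
  = \1_(@blockB R q `|` reflected (@blockB R q)) xi :> R.
Proof.
rewrite !indicE; congr (nat_of_bool _)%:R; apply/idP/idP; rewrite !inE => h.
  by rewrite -[xi]flip1K; exact: flip1_blockBs.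
exact: flip1_blockBs.
Qed.

(** The sum equals its own opposite, by reindexing with the reflection. *)
Lemma sum_hatU_sub (m : freq -> R) q N : (forall xi, m (flip1 xi) = m xi) ->
  \sum_(xi <- box N) m xi * complex.Re (hatU_sub alpha q xi 0 1) = 0.
Proof.
move=> mf; under eq_bigr do rewrite Re_hatU_sub.
pose F xi := m xi * (lambda q%:Z `^ (2 * alpha - 4) *
  (\1_(@blockB R q `|` reflected (@blockB R q)) xi * complex.Re (evec 0 xi 0 1 : R[i]))).
have evN xi :
    complex.Re (evec 0 (flip1 xi) 0 1 : R[i]) = - complex.Re (evec 0 xi 0 1 : R[i]).
  rewrite !evecE -!(rho_eq0) rho_flip1; case: ifP => _; first by rewrite oppr0.
  rewrite [flip1 xi 0 0]mxE [flip1 xi 0 1]mxE /= mulrNz.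
  by rewrite !sub0r mulrN mulrN.
have FN xi : F (flip1 xi) = - F xi.
  by rewrite /F (mf xi) (flip1_indicB q xi) (evN xi) !mulrN.
have : \sum_(xi <- box N) F xi = - \sum_(xi <- box N) F xi.
  rewrite -{1}(reindex_box F flip1K (flip1_box N)) -sumrN.
  by apply: eq_bigr => xi _; exact: FN.
lra.
Qed.

(** This entry is 1 - xi_2^2 / |xi|^2. *)
Lemma Re_evec11_ge0 xi : 0 <= complex.Re (evec 1 xi 0 1 : R[i]).
Proof.
rewrite evecE; case: ifP => [//|/negbT x0]; rewrite /= subr_ge0.
have r0 : 0 < @rho R xi by rewrite lt_neqAle rho_ge0 eq_sym rho_eq0 x0.
rewrite ler_pdivrMl ?exprn_gt0// mulr1 -expr2 -ler_sqrt ?sqr_ge0//.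
rewrite !sqrtr_sqr (ger0_norm (ltW r0)).
by have := le_enorm (freqR xi : 'rV[R]_3) 1; rewrite mxE.
Qed.

Lemma Re_top_ge0 q xi : 0 <= complex.Re (hatU_top alpha q xi 0 1 : R[i]).
Proof.
by rewrite Re_hatU_top mulr_ge0 ?powR_ge0// mulr_ge0 ?Re_evec11_ge0.
Qed.

End HatU.

(** * Contribution of the block A_j at the origin *)

Section InitialField.
Context {R : realType}.
Implicit Types (xi : freq) (q : nat).
Context (chi : R -> R) (hchi : LP_cutoff chi) (alpha : R).

Lemma ler_sum_subseq (T : eqType) (s t : seq T) (F : T -> R) :
  uniq s -> uniq t -> {subset s <= t} -> (forall i, 0 <= F i) ->
  \sum_(i <- s) F i <= \sum_(i <- t) F i.
Proof.
move=> us ut st F0; rewrite [leRHS](bigID (mem s))/= -[X in X + _]big_filter.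
have P : perm_eq [seq i <- t | i \in s] s.
  apply: uniq_perm; rewrite ?filter_uniq// => i; rewrite mem_filter.
  by rewrite andb_idr//; exact: st.
by rewrite (perm_big _ P) lerDl sumr_ge0.
Qed.

(** With n = 2^r and lambda = 32 n, these n^3 frequencies lie in the block A_j,
    in the shell lambda/2 <= |xi| <= lambda where LP_pair is 1: the first
    coordinate is lambda - n - i for some 0 <= i < n, the other two are in
    [0, n[. *)
Definition cell r (f : {ffun 'I_3 -> 'I_(2 ^ r)}) : freq :=
  \row_k (if k == 0 then 31 * (2 ^ r)%:Z - (f k : nat)%:Z else (f k : nat)%:Z).

Lemma cell_inj r : injective (@cell r).
Proof.
move=> f g /rowP fg; apply/ffunP => k; apply: val_inj; have := fg k.
by rewrite !mxE; case: ifP => _ /=; lia.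
Qed.

Lemma cell_bounds r (f : {ffun 'I_3 -> 'I_(2 ^ r)}) : let n : R := 2 ^+ r in
  [/\ 30 * n <= ((cell f 0 0)%:~R : R) <= 31 * n,
      0 <= ((cell f 0 1)%:~R : R) <= n
    & 0 <= ((cell f 0 2%:R)%:~R : R) <= n].
Proof.
have H k : 0 <= ((f k : nat)%:~R : R) <= 2 ^+ r.
  by rewrite -[(f k)%:~R]/((f k : nat)%:R : R) ler0n -natrX ler_nat ltnW.
move=> n; rewrite /cell !mxE /= intrB intrM.
have -> : ((2 ^ r)%N%:Z%:~R : R) = n by rewrite -[LHS]/((2 ^ r)%N%:R) natrX.
have /andP[a0 a1] := H 0; have /andP[b0 b1] := H 1; have /andP[c0 c1] := H 2%:R.
split; apply/andP; split => //.
- by rewrite -/n in a1; lra.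
- by lra.
Qed.

(** On the cube, xi_2^2 <= n^2 <= |xi|^2 / 2, so that p(xi) e_2 has second
    component at least 1/2. *)
Lemma cell_contribution r (f : {ffun 'I_3 -> 'I_(2 ^ r)}) :
  lambda (r + 5)%:Z `^ (2 * alpha - 4) / 2 <=
  LP_pair chi r.+3 (cell f) *
    complex.Re (hatU_top alpha (r + 5) (cell f) 0 1 : R[i]).
Proof.
have n0 : 0 < 2 ^+ r :> R by rewrite exprn_gt0.
have [/andP[a0 a1] /andP[b0 b1] /andP[c0 c1]] := cell_bounds f.
move: n0 a0 a1 b0 b1 c0 c1.
set n : R := 2 ^+ r; set a : R := _%:~R; set b : R := _%:~R; set c : R := _%:~R.
move=> n0 a0 a1 b0 b1 c0 c1.
have r2 : rho (cell f) ^+ 2 = a ^+ 2 + b ^+ 2 + c ^+ 2.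
  rewrite rho_sqr !big_ord_recl big_ord0 addr0 addrA.
  by congr (_ ^+ 2 + _ ^+ 2 + _ ^+ 2); congr ((cell f 0 _)%:~R); apply: val_inj.
have fr k : freqR (cell f) 0 k = (cell f 0 k)%:~R :> R by rewrite mxE.
have ar : a <= rho (cell f).
  have := le_enorm (freqR (cell f) : 'rV[R]_3) 0; rewrite mxE -/a; apply: le_trans.
  exact: ler_norm.
have rpos : 0 < rho (cell f) :> R by apply: lt_le_trans ar; lra.
have rup : rho (cell f) <= 32 * n.
  rewrite -(@ler_pXn2r _ 2)// ?nnegrE ?rho_ge0//; last lra.
  by rewrite r2; nra.
have E4 : 2 ^+ r.+4 = 16 * n :> R by rewrite !exprS -/n; ring.
have E5 : 2 ^+ r.+4.+1 = 32 * n :> R by rewrite !exprS -/n; ring.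
have E5' : 2 ^+ (r + 5) = 32 * n :> R by rewrite exprD -/n; ring.
rewrite LP_pair_eq1//; last by rewrite E4 E5 rup andbT; lra.
rewrite mul1r Re_hatU_top ler_wpM2l ?powR_ge0//.
have -> : \1_(@blockA R (r + 5) `|` reflected (@blockA R (r + 5))) (cell f) = 1 :> R.
  rewrite indicE mem_set//; left; split; rewrite fr lambdaE E5' -/a -/b -/c.
  - by apply/andP; split; lra.
  - by rewrite ger0_norm//; lra.
  - by rewrite ger0_norm//; lra.
rewrite mul1r evecE -(@rho_eq0 R) gt_eqF//= -/b -expr2.
rewrite lerBrDr -lerBrDl ler_pdivrMl ?exprn_gt0//.
rewrite r2; nra.
Qed.

(** The (lambda/32)^3 modes of the cube contribute lambda^(2 alpha - 4) / 2 each,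
    and 2 * 32^3 = 2^16. *)
Lemma sum_hatU_top_ge r :
  (2 ^+ (r + 5)) `^ (2 * alpha - 1) / 2 ^+ 16
  <= \sum_(xi <- box (2 ^ (r + 5).+1))
      LP_pair chi r.+3 xi * complex.Re (hatU_top alpha (r + 5) xi 0 1 : R[i]).
Proof.
set F := fun xi =>
  LP_pair chi r.+3 xi * complex.Re (hatU_top alpha (r + 5) xi 0 1 : R[i]).
have F0 xi : 0 <= F xi.
  by rewrite mulr_ge0 ?Re_top_ge0//; have /andP[] := LP_pair_bound hchi r.+3 xi.
pose s := [seq cell f | f : {ffun 'I_3 -> 'I_(2 ^ r)}].
have lam0 : 0 < lambda (r + 5)%:Z `^ (2 * alpha - 4) / 2 :> R.
  by rewrite divr_gt0// powR_gt0// lambdaE exprn_gt0.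
have us : uniq s by rewrite map_inj_uniq ?enum_uniq//; exact: cell_inj.
have sb : {subset s <= box (2 ^ (r + 5).+1)}.
  move=> xi /mapP[f _ ->]; apply: contraT => /(supported_top alpha) h0.
  have := cell_contribution f; rewrite h0 mxE /= mulr0 => h.
  by have := lt_le_trans lam0 h; rewrite ltxx.
apply: le_trans (ler_sum_subseq us (uniq_box _) sb F0).
rewrite big_map big_enum /=.
apply: (@le_trans _ _ (\sum_(f : {ffun 'I_3 -> 'I_(2 ^ r)})
    lambda (r + 5)%:Z `^ (2 * alpha - 4) / 2)); last first.
  by apply: ler_sum => f _; exact: cell_contribution.
rewrite sumr_const card_ffun !card_ord -[leRHS]mulr_natr.
have -> : ((2 ^ r) ^ 3)%:R = (2 ^+ (r + 5)) ^+ 3 / 2 ^+ 15 :> R.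
  rewrite !natrX exprD exprMn -[X in _ = _ * X / _](exprM 2 5 3).
  rewrite -[(5 * 3)%N]/15%N.
  by rewrite mulfK// expf_neq0.
have -> : 2 * alpha - 1 = (2 * alpha - 4) + 3%:R by ring.
rewrite lambdaE powRD; last by rewrite (gt_eqF (exprn_gt0 _ _)) ?implybT.
rewrite powR_mulrn ?exprn_ge0//.
rewrite (exprS _ 15); set z := 2 ^+ 15.
have z0 : z != 0 :> R by rewrite expf_neq0.
by rewrite le_eqVlt; apply/orP; left; apply/eqP; field.
Qed.

End InitialField.

(** * Times of H^1 regularity, and L^2 bounds *)

Section Final.
Context {R : realType}.
Implicit Types (xi : freq).

(** Monotonicity without measurability, straight from the definition of the
    integral as a supremum over simple functions: the measurability of
    t |-> H1_norm (u t) is not known. *)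
Lemma ge0_le_integral_nonmeas d (T : measurableType d)
    (mu : {measure set T -> \bar R}) (D : set T) (f g : T -> \bar R) :
  (forall x, (0 <= f x)%E) -> (forall x, (f x <= g x)%E) ->
  (\int[mu]_(x in D) f x <= \int[mu]_(x in D) g x)%E.
Proof.
move=> f0 fg; have g0 x : (0 <= g x)%E by exact: le_trans (f0 x) (fg x).
rewrite !ge0_integralE//; apply: ge_ereal_sup => _ [h /= hf <-].
apply: ereal_sup_ubound; exists h => //= x; apply: le_trans (hf x) _.
by rewrite /patch; case: ifP.
Qed.

Lemma H1_norm_ge0 (f : pt3 R -> 'rV[R]_3) : (0 <= H1_norm f)%E.
Proof. by apply: le_ereal_inf_tmp => _ [g _ <-]; exact: Lnorm_ge0. Qed.

(** An infinite H^1 norm on all of ]0, e[ would make the integral infinite. *)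
Lemma in_L2H1_frequently (T : R) (u : velocity) (e : R) : 0 < e -> e <= T ->
  in_L2H1 T u -> exists2 t, 0 < t < e & (H1_norm (u t) < +oo)%E.
Proof.
move=> e0 eT; apply: contraPP => hn.
have hoo t : 0 < t < e -> H1_norm (u t) = +oo%E.
  move=> te; apply/eqP; rewrite -leye_eq leNgt; apply/negP => h.
  by apply: hn; exists t.
apply/negP; rewrite -leNgt leye_eq; apply/eqP/eqP; rewrite -leye_eq.
pose g (t : R) : \bar R := if (0 < t < e) then +oo%E else 0%E.
have mI : measurable (`]0, e[%classic : set R) by exact: measurable_itv.
apply: (@le_trans _ _ (\int[lebesgue_measure]_(t in `[0%R, T[) g t)%E); last first.
  apply: ge0_le_integral_nonmeas => t; rewrite /g; first by case: ifP.
  by case: ifP => [/hoo ->|_] //; rewrite expe_ge0 // H1_norm_ge0.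
rewrite (_ : g = (cst +oo%E) \_ `]0, e[%classic); last first.
  by apply/funext => t; rewrite /g patchE mem_setE /= in_itv.
rewrite -integral_mkcondr /= integral_cst; last exact: measurableI.
rewrite setIidr; last by apply: subset_itv; rewrite bnd_simp.
have mE : lebesgue_measure (`]0, e[%classic : set R) = e%:E.
  by rewrite lebesgue_measure_itv /= lte_fin e0 -EFinB subr0.
rewrite [X in (_ * X)%E](_ : _ = e%:E); last exact: mE.
by rewrite gt0_mulye ?lte_fin.
Qed.

Lemma Lp2_component (w : pt3 R -> 'rV[R]_3) (e : R) k :
  (forall k, measurable_fun setT (fun x => w x 0 k)) -> 0 <= e ->
  (Lp_norm 2%:E w <= e%:E)%E ->
  tint (fun x => w x 0 k ^+ 2)
  /\ \int[torus_measure]_x (w x 0 k ^+ 2) <= e ^+ 2.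
Proof.
move=> mw e0 we.
have msq j : measurable_fun setT (fun x => w x 0 j ^+ 2) by exact: measurable_funX.
have men : measurable_fun setT (fun x => enorm (w x)).
  have ms : measurable_fun setT (@Num.sqrt R).
    by apply: continuous_measurable_fun; exact: sqrt_continuous.
  apply: (measurableT_comp ms).
  under eq_fun do rewrite !big_ord_recl big_ord0.
  by repeat apply: measurable_funD.
have I2 : (\int[torus_measure]_x (w x 0 k ^+ 2)%:E <= (e ^+ 2)%:E)%E.
  apply: (@le_trans _ _ (\int[torus_measure]_x (`|(enorm (w x))%:E| `^ 2)%E)%E).
    apply: ge0_le_integral => //.
    - by move=> x _; rewrite lee_fin sqr_ge0.
    - by apply/measurable_EFinP; exact: msq.
    - under eq_fun do rewrite abse_EFin poweR_EFin (ger0_norm (sqrtr_ge0 _)).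
      apply/measurable_EFinP.
      apply: (@measurableT_comp _ _ _ _ _ _ (fun t : R => t `^ 2)).
        exact: measurable_powR.
      exact: men.
    - move=> x _; rewrite abse_EFin poweR_EFin lee_fin powR_mulrn//.
      rewrite -[leLHS]real_normK ?num_real// lerXn2r ?nnegrE//.
      by rewrite (ger0_norm (sqrtr_ge0 _)) le_enorm.
  rewrite -poweR_Lnorm//.
  have -> : (e ^+ 2)%:E = (e%:E `^ 2)%E by rewrite poweR_EFin powR_mulrn.
  by apply: gt0_ler_poweR => //; rewrite in_itv /= ?Lnorm_ge0 ?lee_fin ?e0 leey.
have I0 : (0 <= \int[torus_measure]_x (w x 0 k ^+ 2)%:E)%E.
  by apply: integral_ge0 => x _; rewrite lee_fin sqr_ge0.
split.
  apply/integrableP; split; first by apply/measurable_EFinP; exact: msq.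
  under eq_integral do rewrite /= ger0_norm ?sqr_ge0//.
  by rewrite (le_lt_trans I2)// ltry.
rewrite /Rintegral -lee_fin fineK// ge0_fin_numE//.
by rewrite (le_lt_trans I2)// ltry.
Qed.

End Final.

(** * The gap between H^1 and the initial field *)

Section Main.
Context {R : realType}.
Implicit Types (xi : freq).
Context (chi : R -> R) (hchi : LP_cutoff chi) (alpha : R).

Lemma LP_pair_flip1 p xi : LP_pair chi p (flip1 xi) = LP_pair chi p xi.
Proof. by rewrite !LP_pairE rho_flip1. Qed.

Lemma partialUE q n (x : pt3 R) k : partialU alpha q n x 0 k
  = \sum_(j < n) (synthesis (hatU_top alpha (q j)) x 0 k
                  + synthesis (hatU_sub alpha (q j)) x 0 k).
Proof. by rewrite /partialU summxE; apply: eq_bigr => j _; rewrite mxE. Qed.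

Lemma tint_partialU q n k : tint (fun x : pt3 R => partialU alpha q n x 0 k).
Proof.
under eq_fun do rewrite partialUE.
apply: tint_sum => j; apply: tintD; apply: tint_synthesis.
  exact: supported_top.
exact: supported_sub.
Qed.

(** Every scale contributes a nonnegative amount to the sum, of which only the
    i-th one is kept. *)
Lemma partialU_pairing q n i r : (i < n)%N -> q i = (r + 5)%N ->
  (2 * pi) ^+ 3 * ((2 ^+ (r + 5)) `^ (2 * alpha - 1) / 2 ^+ 16)
  <= \int[torus_measure]_x
       (partialU alpha q n x 0 1 * kernel (LP_pair chi r.+3) (2 ^ r.+3.+3) x).
Proof.
move=> ltin qi; set M := (2 ^ r.+3.+3)%N; set m := LP_pair chi r.+3.
have me : even_on_box m M by exact: LP_pair_even.
have tk f : tint f -> tint (fun x : pt3 R => f x * kernel m M x).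
  exact: tintM_kernel.
have tt j := tint_synthesis 1 (@supported_top R alpha (q j)).
have ts j := tint_synthesis 1 (@supported_sub R alpha (q j)).
under eq_Rintegral do rewrite partialUE mulr_suml.
rewrite (@Rintegral_sum _ _ _ (fun (j : 'I_n) x =>
  (synthesis (hatU_top alpha (q j)) x 0 1 +
   synthesis (hatU_sub alpha (q j)) x 0 1) * kernel m M x)); last first.
  by move=> j; apply: tk; apply: tintD.
have E (j : 'I_n) :
  \int[torus_measure]_x ((synthesis (hatU_top alpha (q j)) x 0 1 +
   synthesis (hatU_sub alpha (q j)) x 0 1) * kernel m M x)
   = (2 * pi) ^+ 3 * \sum_(xi <- box (2 ^ (q j).+1))
       m xi * complex.Re (hatU_top alpha (q j) xi 0 1 : R[i]).
  under eq_Rintegral do rewrite mulrDl.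
  rewrite RintegralD//; try exact: tk.
  apply: etrans (congr2 +%R
    (integral_synthesis_kernel 1 (@supported_top R alpha (q j)) me)
    (integral_synthesis_kernel 1 (@supported_sub R alpha (q j)) me)) _.
  rewrite [X in _ + _ * X](sum_hatU_sub alpha (q j) _ (LP_pair_flip1 r.+3)).
  by rewrite mulr0 addr0.
rewrite (eq_bigr _ (fun j _ => E j)) -mulr_sumr ler_wpM2l//.
  by rewrite exprn_ge0// mulr_ge0 ?pi_ge0.
rewrite (bigD1 (Ordinal ltin))//= qi.
apply: (le_trans (sum_hatU_top_ge hchi alpha r)).
rewrite lerDl; apply: sumr_ge0 => j _; apply: sumr_ge0 => xi _.
by rewrite mulr_ge0 ?Re_top_ge0//; have /andP[] := LP_pair_bound hchi r.+3 xi.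
Qed.

(** Pairing with a fixed kernel is continuous in L^2, so that the lower bound for
    the partial sums, uniform in n, passes to the limit. *)
Lemma initial_field_pairing q (U : pt3 R -> 'rV[R]_3) i r :
  is_initial_field alpha q U -> q i = (r + 5)%N ->
  (2 * pi) ^+ 3 * ((2 ^+ (r + 5)) `^ (2 * alpha - 1) / 2 ^+ 16)
  <= \int[torus_measure]_x
       (U x 0 1 * kernel (LP_pair chi r.+3) (2 ^ r.+3.+3) x).
Proof.
move=> [U2 Ulim] qi; set K := kernel _ _.
pose kap := \int[torus_measure]_x (K x ^+ 2).
have kap0 : 0 <= kap by apply: Rintegral_ge0 => x _; exact: sqr_ge0.
apply/ler_addgt0Pr => e e0.
(* chosen so that (s + s * kap) / 2 = e *)
pose s := 2 * e / (1 + kap).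
have k1 : 0 < 1 + kap by rewrite ltr_pwDl.
have s0 : 0 < s by rewrite divr_gt0// mulr_gt0.
have [n [ltin hn]] : exists n, (i < n)%N /\
    (Lp_norm 2%:E (fun x => (U x - partialU alpha q n x)%R) <= s%:E)%E.
  have h0 : nbhs (0%E : \bar R) [set y | (y < s%:E)%E].
    by apply: open_ereal_lt'; rewrite lte_fin.
  have [N _ hN] := Ulim _ h0.
  exists (maxn N i.+1); split; first by rewrite leq_max ltnSn orbT.
  by apply/ltW/hN => /=; rewrite leq_maxl.
have tU : tint (fun x => U x 0 1) by exact: Lfun2_tint.
have tP := tint_partialU q n 1.
have meas k : measurable_fun setT (fun x => (U x - partialU alpha q n x) 0 k).
  have : tint (fun x => U x 0 k - partialU alpha q n x 0 k).
    by apply: tintB; [exact: Lfun2_tint|exact: tint_partialU].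
  move=> /measurable_int/measurable_EFinP.
  rewrite (_ : (fun x => _) = (fun x => U x 0 k - partialU alpha q n x 0 k))//.
  by apply/funext => x; rewrite !mxE.
have [t2 i2] := Lp2_component 1 meas (ltW s0) hn.
have tk : tint (fun x => (U x - partialU alpha q n x) 0 1 * K x).
  apply: tintM_kernel.
  rewrite (_ : (fun x => _) = (fun x => U x 0 1 - partialU alpha q n x 0 1)).
    exact: tintB.
  by apply/funext => x; rewrite !mxE.
have := integral_young (s := s^-1) _ t2 tk (tint_kernel_sqr _ _).
rewrite invr_gt0 => /(_ s0); rewrite invrK -/K -/kap => hy.
have hP := partialU_pairing ltin qi.
apply: le_trans hP _; rewrite -/K -lerBlDl.
have -> : \int[torus_measure]_x (partialU alpha q n x 0 1 * K x)
    - \int[torus_measure]_x (U x 0 1 * K x)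
  = - \int[torus_measure]_x ((U x - partialU alpha q n x) 0 1 * K x).
  have E x : (U x - partialU alpha q n x) 0 1 * K x
      = U x 0 1 * K x - partialU alpha q n x 0 1 * K x.
    by rewrite !mxE mulrBl.
  under [in RHS]eq_Rintegral do rewrite E.
  rewrite RintegralB//; [ring|exact: tintM_kernel|exact: tintM_kernel].
apply: (le_trans (ler_norm _)); rewrite normrN; apply: (le_trans hy).
apply: (@le_trans _ _ (2^-1 * (s + s * kap))).
  by rewrite ler_pM2l// lerD2r ler_pdivrMl.
by rewrite /s -[X in X + _]mulr1 -mulrDr divfK ?gt_eqF// mulKf.
Qed.

(** Half of 2^-18: the two blocks together then account for
    2^-18 lambda^(2 alpha - 1), a quarter of the lower bound
    2^-16 lambda^(2 alpha - 1) for U. *)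
Definition gap : R := 2^-1 * 2 ^- 18.

(** Up to the factor (2 pi)^3 of all the pairings: if the norm were below gap,
    then along the scales lambda = 2^(q_i) the bound 2^-16 lambda^(2 alpha - 1)
    for U would have to be covered by 2^-18 lambda^(2 alpha - 1) from v - U,
    by at most 2^-18 lambda from the kernel term of H1_pairing, and by a
    constant: impossible for large i. *)
Lemma besov_gap (q : nat -> nat) (U v : pt3 R -> 'rV[R]_3) : 1 <= alpha ->
  {homo q : i j / (i < j)%N} -> is_initial_field alpha q U -> L2 v ->
  (H1_norm v < +oo)%E ->
  (gap%:E <= besov_norm chi (1 - 2 * alpha) +oo (fun x => (v x - U x)%R))%E.
Proof.
move=> a1 qmono hU v2 /ereal_inf_lt[_ [g [g2 vg] <-] _].
rewrite leNgt; apply/negP => hlt.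
set w := fun x => v x - U x.
have qge i : (i <= q i)%N.
  by elim: i => // i IH; exact: leq_ltn_trans IH (qmono _ _ (ltnSn i)).
set P : R := (2 * pi) ^+ 3.
have P0 : 0 < P by rewrite exprn_gt0// mulr_gt0 ?pi_gt0.
set z : R := 2 ^- 18.
have z0 : 0 < z by rewrite invr_gt0 exprn_gt0.
have gz : gap = 2^-1 * z by [].
set G := \int[torus_measure]_x (g x 0 1 ^+ 2).
have block qq :
    (Lp_norm +oo (LP_block chi qq w) <= (gap * (2 ^+ qq) `^ (2 * alpha - 1))%:E)%E.
  have l0 : 0 < lambda qq%:Z `^ (1 - 2 * alpha) :> R by rewrite powR_gt0// exprn_gt0.
  have : ((lambda qq%:Z `^ (1 - 2 * alpha))%:E
          * Lp_norm +oo (LP_block chi qq w) <= gap%:E)%E.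
    by apply: le_trans (ltW hlt); apply: ereal_sup_ubound; exists qq.
  rewrite -lee_pdivlMl// -EFinM => h; apply: (le_trans h).
  by rewrite lee_fin -powRN opprB mulrC.
(* i <= q i, so that q i has the form r + 5 for 5 <= i *)
have key i : (5 <= i)%N -> 2 * z * P * 2 ^+ (q i) <= 2^-1 * (2 ^+ 28 * G).
  move=> i5; have qi : q i = ((q i - 5) + 5)%N by rewrite subnK// (leq_trans i5).
  move: (q i - 5)%N qi => r qi; rewrite qi.
  set L : R := 2 ^+ (r + 5); set X := L `^ (2 * alpha - 1).
  have L1 : 1 <= L by rewrite exprn_ege1// ler1n.
  have LX : L <= X.
    by rewrite -[leLHS]powRr1 ?(le_trans ler01)// ler_powR//; lra.
  have tv : tint (fun x => v x 0 1) by exact: Lfun2_tint.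
  have tU : tint (fun x => U x 0 1) by apply: Lfun2_tint; exact: hU.1.
  have wE x : w x 0 1 = v x 0 1 - U x 0 1 by rewrite !mxE.
  have tw : tint (fun x => w x 0 1).
    by under eq_fun do rewrite wE; exact: tintB.
  set K := kernel (LP_pair chi r.+3) (2 ^ r.+3.+3).
  have h1 := initial_field_pairing hU qi; rewrite -/L -/X -/P -/K in h1.
  (* s = 2^28 makes the kernel term s^-1 2^11 lambda / 2 equal to 2^-18 lambda *)
  have s0 : 0 < 2 ^+ 28 :> R by rewrite exprn_gt0.
  have h2 := H1_pairing (k := 1) hchi r.+3 s0 g2 vg tv.
  have h3 := LP_pair_pairing hchi (leqnn _) tw (block r.+4) (block r.+4.+1).
  rewrite -/K -/P -/G in h2; rewrite -/K -/P in h3.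
  have c1 : (2 ^+ 28)^-1 * (P * (2 ^+ 11 * 2 ^+ r.+3.+2)) = 2 * (z * P * L).
    rewrite (_ : 2 ^+ r.+3.+2 = L); last by rewrite /L addnC.
    rewrite /z (exprD 2 11 17) (exprS 2 17).
    have x0 : 2 ^+ 11 != 0 :> R by rewrite expf_neq0.
    have y0 : 2 ^+ 17 != 0 :> R by rewrite expf_neq0.
    move: (2 ^+ 11 : R) (2 ^+ 17 : R) x0 y0 => x y x0 y0.
    by field; rewrite x0 y0.
  have c2 : X / 2 ^+ 16 = 4 * z * X.
    rewrite /z (exprD 2 2 16).
    have y0 : 2 ^+ 16 != 0 :> R by rewrite expf_neq0.
    by move: (2 ^+ 16 : R) y0 => y y0; field.
  have D1 : (2 ^+ r.+4) `^ (2 * alpha - 1) <= X.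
    have a0 : 0 <= 2 * alpha - 1 by lra.
    apply: (ge0_ler_powR a0); rewrite ?nnegrE ?exprn_ge0//.
    by rewrite ler_eXn2l ?ltr1n// -addn4 leq_add2l.
  have D2 : (2 ^+ r.+4.+1) `^ (2 * alpha - 1) = X by rewrite /X /L addnC.
  rewrite D2 in h3.
  have h3' : `|\int[torus_measure]_x (w x 0 1 * K x)| <= z * P * X.
    apply: (le_trans h3); rewrite -mulrDr gz.
    have -> : z * P * X = P * (2^-1 * z * (X + X)) by field.
    by rewrite ler_pM2l// ler_pM2l ?mulr_gt0// lerD2r.
  have split_int : \int[torus_measure]_x (w x 0 1 * K x)
      = \int[torus_measure]_x (v x 0 1 * K x)
        - \int[torus_measure]_x (U x 0 1 * K x).
    under eq_Rintegral do rewrite wE mulrBl.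
    by rewrite RintegralB//; exact: tintM_kernel.
  rewrite split_int in h3'; rewrite c1 in h2; rewrite c2 in h1.
  move: h1 h2 h3'; move: (\int[torus_measure]_x (U x 0 1 * K x)) => IU.
  move: (\int[torus_measure]_x (v x 0 1 * K x)) => IV h1 h2 h3'.
  have zPX : z * P * L <= z * P * X.
    by apply: ler_wpM2l => //; rewrite mulr_ge0 ?ltW.
  have e1 : P * (4 * z * X) = 4 * (z * P * X) by ring.
  have e2 : 2 * z * P * L = 2 * (z * P * L) by ring.
  rewrite e1 in h1; rewrite e2.
  move: h2 h3'; rewrite !ler_norml => /andP[_ h2] /andP[h3' _].
  move: (z * P * L) (z * P * X) zPX h1 h2 h3' => ? ? ? ? ? ?.
  lra.
have G0 : 0 <= G by apply: Rintegral_ge0 => x _; exact: sqr_ge0.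
pose C : R := 2^-1 * (2 ^+ 28 * G) / (2 * z * P).
have zP0 : 0 < 2 * z * P by apply: mulr_gt0 => //; apply: mulr_gt0.
have C0 : 0 <= C.
  by apply: divr_ge0; [rewrite !mulr_ge0// exprn_ge0|exact: ltW].
have := key (5 + Num.bound C)%N (leq_addr _ _).
rewrite -ler_pdivlMl// mulrC -/C leNgt => /negP; apply.
apply: (lt_le_trans (archi_boundP C0)).
rewrite -natrX ler_nat (leq_trans (leq_addl 5 _))// (leq_trans (qge _))//.
exact/ltnW/ltn_expl.
Qed.

End Main.

Theorem proposition2p2 (R : realType) (chi : R -> R) (nu alpha T : R)
    (q : nat -> nat) (U : pt3 R -> 'rV[R]_3)
    (hchi : LP_cutoff chi) (hnu : 0 < nu) (halpha : 1 <= alpha < 5 / 4)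
    (hT : 0 < T) (hq : admissible_scales alpha q)
    (hU : is_initial_field alpha q U) :
  (forall u : velocity, weak_solution nu alpha T U u ->
     exists delta : R, 0 < delta /\
       (delta%:E <= besov_limsup chi alpha U u)%E) /\
  (exists delta : R, 0 < delta /\
     forall u : velocity, weak_solution nu alpha T U u ->
       energy_inequality nu alpha T U u ->
       (delta%:E <= besov_limsup chi alpha U u)%E).
Proof.
have gap0 : 0 < gap :> R by rewrite /gap mulr_gt0 ?invr_gt0 ?exprn_gt0.
suff main u : weak_solution nu alpha T U u ->
    (gap%:E <= besov_limsup chi alpha U u)%E.
  by split=> [u /main|]; exists gap; split=> // u /main.
case=> -[uL2 _] uH1 _ _ _; apply: le_ereal_inf_tmp => _ [V V0 <-].
have [e /= e0 eV] : exists2 e : R, 0 < e & forall t, 0 < t < e -> V t.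
  case: V0 => e /= e0 eV; exists e => // t /andP[t0 te]; apply: eV => //=.
  by rewrite sub0r normrN gtr0_norm.
have m0 : 0 < Num.min e T by rewrite lt_min e0 hT.
have mT : Num.min e T <= T by rewrite ge_min lexx orbT.
have [t /andP[t0 tm] ht] := in_L2H1_frequently m0 mT uH1.
move: tm; rewrite lt_min => /andP[te tT].
apply: (@le_trans _ _
  (besov_norm chi (1 - 2 * alpha) +oo%E (fun x => u t x - U x))).
  apply: (besov_gap hchi _ hq.1 hU) => //; first by case/andP: halpha.
  by apply: uL2; rewrite ltW.
by apply: ereal_sup_ubound; exists t => //; apply: eV; rewrite t0.
Qed.
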